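(* Let $k$ be an infinite field with $\operatorname{char}k\ne2$. For parameters $(a_0,\dots,a_4,b_0,\dots,b_3,c_0,\dots,c_3,d_0,d_1,d_2,g_0,g_1,g_2,h_0,h_1,h_2)$ in $k$ with $h_2\neq0$, let $\mathcal{C}_{0,1}\subset\mathbb{P}(\mathcal{O}_{\mathbb{P}^1}(2)\oplus\mathcal{O}_{\mathbb{P}^1}(1)\oplus\mathcal{O}_{\mathbb{P}^1}(1))$ be the conic bundle of multidegree $(4,3,3,2,2,2)$ with these coefficients, and let $\mathcal{C}_{1,0}\subset\mathbb{P}(\mathcal{O}_{\mathbb{P}^1}(2)\oplus\mathcal{O}_{\mathbb{P}^1}(2)\oplus\mathcal{O}_{\mathbb{P}^1})$ be its specialization of multidegree $(4,4,2,4,2,0)$ (both defined in the context). If $\mathcal{C}_{0,1}$ lies in the quadric $\mathcal{U}=\{a_0=a_1=a_3=a_4=0,\ b_0c_3-c_0b_3=0\}\subset\mathbb{P}(V^1_{4,3,3,2,2,2})$, then $\mathcal{C}_{1,0}$ is unirational over $k$. Moreover, $\mathcal{U}$ specializes to a subvariety $\mathcal{U}'\subset\mathbb{P}(V^1_{4,4,2,4,2,0})$ (the locus of the specializations $\mathcal{C}_{1,0}$ of the elements $\mathcal{C}_{0,1}$ of $\mathcal{U}$) such that the orbit $\chi(\mathcal{G}_{2,2,0}\times\mathcal{U}')$ is Zariski dense in $\mathbb{P}(V^1_{4,4,2,4,2,0})$.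
   Context: For $a_0\ge a_1\ge a_2\ge0$, $\mathcal{T}_{a_0,a_1,a_2}=\mathbb{P}(\mathcal{O}_{\mathbb{P}^1}(a_0)\oplus\mathcal{O}_{\mathbb{P}^1}(a_1)\oplus\mathcal{O}_{\mathbb{P}^1}(a_2))$ is the toric variety with Cox ring $k[x_0,x_1,y_0,y_1,y_2]$, $\deg x_i=(1,0)$, $\deg y_i=(-a_i,1)$, irrelevant ideal $(x_0,x_1)\cap(y_0,y_1,y_2)$. $\mathbb{P}(V^1_{4,3,3,2,2,2})$ and $\mathbb{P}(V^1_{4,4,2,4,2,0})$ (both $\cong\mathbb{P}^{21}$) parametrize equations $\sum_{i\le j}s_{ij}y_iy_j=0$ up to scaling in $\mathcal{T}_{2,1,1}$, resp. $\mathcal{T}_{2,2,0}$, with $(s_{00},s_{01},s_{02},s_{11},s_{12},s_{22})$ homogeneous in $x_0,x_1$ of the indicated degrees. $\mathcal{C}_{0,1}\subset\mathcal{T}_{2,1,1}$ is given by $s_{00}=\sum_{i=0}^4a_ix_0^{4-i}x_1^i$, $s_{01}=\sum_{i=0}^3b_ix_0^{3-i}x_1^i$, $s_{02}=\sum_{i=0}^3c_ix_0^{3-i}x_1^i$, $s_{11}=\sum_{i=0}^2d_ix_0^{2-i}x_1^i$, $s_{12}=\sum_{i=0}^2g_ix_0^{2-i}x_1^i$, $s_{22}=\sum_{i=0}^2h_ix_0^{2-i}x_1^i$. $\mathcal{C}_{1,0}\subset\mathcal{T}_{2,2,0}$ is given by $s_{00}=a_0x_0^4+a_1x_0^3x_1+a_2x_0^2x_1^2+a_3x_0x_1^3+a_4x_1^4$,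 $s_{01}=b_0x_0^4+b_1x_0^3x_1+b_2x_0^2x_1^2+b_3x_0x_1^3+c_0x_0^2x_1^2+c_1x_0x_1^3+c_2x_1^4$, $s_{02}=c_3x_1^2$, $s_{11}=d_0x_0^4+d_1x_0^3x_1+d_2x_0^2x_1^2+g_0x_0^2x_1^2+g_1x_0x_1^3+h_0x_1^4$, $s_{12}=g_2x_0x_1+h_1x_1^2$, $s_{22}=h_2$. These are the fibers over $[0:1]$ and $[1:0]$ of a one-parameter family of conic bundles over $\mathbb{P}^1$, obtained by cutting with one fixed quadric a family of threefolds in $\mathbb{P}^6$ degenerating $\mathcal{T}_{2,1,1}$ to (a contraction of) $\mathcal{T}_{2,2,0}$. $\mathcal{G}_{2,2,0}=\operatorname{Aut}(\mathcal{T}_{2,2,0})$ and $\chi(\varphi,\mathcal{Q}^1)=\varphi^*\mathcal{Q}^1$.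
   Formalization: Unirationality is proved when C_{1,0} has smooth generic fibre and c_3≠0 or -a_2h_2 is a square in k; as stated it fails, e.g. over the reals with a_2=d_0=h_0=h_2=1 and all other coefficients 0, where C_{1,0} has only two real points. *)

(* Defs.v *)
From mathcomp Require Import all_boot all_order all_algebra.
From mathcomp Require Import mpoly.

Set Implicit Arguments.
Unset Strict Implicit.
Unset Printing Implicit Defensive.

Import GRing.Theory.
Local Open Scope ring_scope.

Definition infinite_type (T : eqType) : Prop :=
  forall s : seq T, exists x : T, x \notin s.

(* The Cox ring k[x_0,x_1,y_0,y_1,y_2] of T_w, w = [:: w_0; w_1; w_2], is
   {mpoly k[5]}: variables 0, 1 are x_0, x_1 and variables 2, 3, 4 are
   y_0, y_1, y_2. *)
Definition vdeg (w : seq nat) (i : nat) : int * int :=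
  if (i < 2)%N then (1, 0) else (- (nth 0%N w (i - 2)%N)%:Z, 1).

Definition bideg (w : seq nat) (m : 'X_{1..5}) : int * int :=
  \sum_(i < 5) vdeg w i *+ m i.

Definition bihomog (k : fieldType) (w : seq nat) (b : int * int)
    (F : {mpoly k[5]}) : Prop :=
  forall m, m \in msupp F -> bideg w m = b.

(* Value of F at p, its coefficients being pushed forward along iota. *)
Definition eval_at (k L : fieldType) (n : nat) (iota : k -> L)
    (p : 'I_n -> L) (F : {mpoly k[n]}) : L :=
  mmap iota p F.

(* p lies outside the zero locus of (x_0,x_1) \cap (y_0,y_1,y_2). *)
Definition stable (L : fieldType) (p : 'I_5 -> L) : bool :=
  [exists i : 'I_5, (i < 2)%N && (p i != 0)]
  && [exists i : 'I_5, (2 <= i)%N && (p i != 0)].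

(* For a field L, T_w(L) is the set of stable p : 'I_5 -> L modulo the action
   of the torus Hom(Z^2, G_m)(L), i.e. of pairs of units of L. *)
Definition same_point (w : seq nat) (L : fieldType) (p q : 'I_5 -> L) : Prop :=
  exists lam mu : L, [/\ lam != 0, mu != 0 &
    forall i, q i = lam ^ (vdeg w i).1 * mu ^ (vdeg w i).2 * p i].

(* Morphisms T_w -> T_w in homogeneous coordinates (Cox's functor of points):
   sections of O(d) for the x_i and of O(e - w_j d) for the y_j, without
   base points.  Here d, e in Pic T_w = Z^2 are the pullbacks of the classes
   (1,0) and (0,1). *)
Definition toric_endo (k : fieldType) (w : seq nat)
    (phi : 5.-tuple {mpoly k[5]}) : Prop :=
  (exists d e : int * int, forall i : 'I_5,
      bihomog w (d *~ (vdeg w i).1 + e *~ (vdeg w i).2) (tnth phi i))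
  /\ (forall (L : fieldType) (iota : {rmorphism k -> L}) (p : 'I_5 -> L),
      stable p -> stable (fun i => eval_at iota p (tnth phi i))).

Definition inverse_endo (k : fieldType) (w : seq nat)
    (phi psi : 5.-tuple {mpoly k[5]}) : Prop :=
  forall (L : fieldType) (iota : {rmorphism k -> L}) (p : 'I_5 -> L),
    stable p ->
    same_point w p (fun i => eval_at iota
      (fun j => eval_at iota p (tnth phi j)) (tnth psi i)).

Definition toric_aut (k : fieldType) (w : seq nat)
    (phi : 5.-tuple {mpoly k[5]}) : Prop :=
  toric_endo w phi /\
  exists psi : 5.-tuple {mpoly k[5]},
    [/\ toric_endo w psi, inverse_endo w phi psi & inverse_endo w psi phi].

(* A nonconstant point x of P^1(L), seen over k, is the generic point of P^1_k
   iff no nonzero form over k vanishes at it. *)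
Definition generic_P1 (k L : fieldType) (iota : k -> L) (x : 'I_2 -> L) : Prop :=
  forall (d : nat) (f : {mpoly k[2]}),
    f \is d.-homog -> f != 0 -> eval_at iota x f != 0.

(* Jacobian criterion for the generic fibre, over the generic point of P^1, of
   {F = 0} in T_w; F is the equation of a conic in the y_j. *)
Definition smooth_generic_fibre (k : fieldType) (F : {mpoly k[5]}) : Prop :=
  forall (L : fieldType) (iota : {rmorphism k -> L}) (p : 'I_5 -> L),
    stable p ->
    generic_P1 iota (fun i : 'I_2 => p (widen_ord (isT : (2 <= 5)%N) i)) ->
    eval_at iota p F = 0 ->
    exists2 j : 'I_5, (2 <= j)%N & eval_at iota p (mderiv j F) != 0.

(* Existence of a dominant rational map from some A^N to X = {F = 0} in T_w.
   The rational map is a point of X over the function field of A^N; it is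
   dominant when every closed subset {G = 0} of T_w which contains that point
   contains all of X, i.e. all points of X over all extensions of k. *)
Definition unirational (k : fieldType) (w : seq nat) (F : {mpoly k[5]}) : Prop :=
  exists (N : nat) (phi : 'I_5 -> {fraction {mpoly k[N]}}),
    let iotaK := fun c : k => tofrac (mpolyC N c) in
    [/\ stable phi,
        eval_at iotaK phi F = 0 &
        forall (b : int * int) (G : {mpoly k[5]}),
          bihomog w b G -> eval_at iotaK phi G = 0 ->
          forall (L : fieldType) (iota : {rmorphism k -> L}) (p : 'I_5 -> L),
            stable p -> eval_at iota p F = 0 -> eval_at iota p G = 0].

Definition quad_pairs : seq (nat * nat) :=
  [:: (0, 0); (0, 1); (0, 2); (1, 1); (1, 2); (2, 2)]%N.

(* The monomials x_0^(d-l) x_1^l y_i y_j with d = w_i + w_j = deg s_ij, for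
   (i,j) in the order 00, 01, 02, 11, 12, 22 and l = 0, ..., d: a basis of the
   bidegree (0,2) part of the Cox ring.  There are 22 of them both for
   w = [:: 2; 1; 1] (degrees 4,3,3,2,2,2) and w = [:: 2; 2; 0]
   (degrees 4,4,2,4,2,0). *)
Definition conic_basis (k : fieldType) (w : seq nat) : seq {mpoly k[5]} :=
  [seq 'X_(inord 0) ^+ (nth 0 w ij.1 + nth 0 w ij.2 - l)%N * 'X_(inord 1) ^+ l
       * ('X_(inord (2 + ij.1)) * 'X_(inord (2 + ij.2)))
  | ij <- quad_pairs, l <- iota 0 (nth 0 w ij.1 + nth 0 w ij.2).+1].

(* P(V^1) = P^21; its points are nonzero v : 'rV[k]_22 up to scaling, standing
   for the equation sum_(i <= j) s_ij y_i y_j = 0 with coefficients v. *)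
Definition conic (k : fieldType) (w : seq nat) (v : 'rV[k]_22) : {mpoly k[5]} :=
  \sum_(n < 22) v 0 n *: (conic_basis k w)`_n.

(* The coefficients of C_{0,1}, read off its coordinate vector in the order
   a_0..a_4, b_0..b_3, c_0..c_3, d_0..d_2, g_0..g_2, h_0..h_2. *)
Definition pa (k : fieldType) (v : 'rV[k]_22) (i : nat) : k := v 0 (inord i).
Definition pb (k : fieldType) (v : 'rV[k]_22) (i : nat) : k := v 0 (inord (5 + i)).
Definition pc (k : fieldType) (v : 'rV[k]_22) (i : nat) : k := v 0 (inord (9 + i)).
Definition pd (k : fieldType) (v : 'rV[k]_22) (i : nat) : k := v 0 (inord (13 + i)).
Definition pg (k : fieldType) (v : 'rV[k]_22) (i : nat) : k := v 0 (inord (16 + i)).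
Definition ph (k : fieldType) (v : 'rV[k]_22) (i : nat) : k := v 0 (inord (19 + i)).

Definition C01 (k : fieldType) (v : 'rV[k]_22) : {mpoly k[5]} :=
  conic [:: 2; 1; 1]%N v.

Definition specialize (k : fieldType) (v : 'rV[k]_22) : 'rV[k]_22 :=
  \row_(n < 22)
    [:: pa v 0; pa v 1; pa v 2; pa v 3; pa v 4;
        pb v 0; pb v 1; pb v 2 + pc v 0; pb v 3 + pc v 1; pc v 2;
        0; 0; pc v 3;
        pd v 0; pd v 1; pd v 2 + pg v 0; pg v 1; ph v 0;
        0; pg v 2; ph v 1;
        ph v 2]`_n.

Definition C10 (k : fieldType) (v : 'rV[k]_22) : {mpoly k[5]} :=
  conic [:: 2; 2; 0]%N (specialize v).

Definition in_U (k : fieldType) (v : 'rV[k]_22) : Prop :=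
  [/\ pa v 0 = 0, pa v 1 = 0, pa v 3 = 0, pa v 4 = 0 &
      pb v 0 * pc v 3 - pc v 0 * pb v 3 = 0].

Definition U' (k : fieldType) (u : 'rV[k]_22) : Prop :=
  exists v : 'rV[k]_22, [/\ ph v 2 != 0, in_U v & u = specialize v].

(* Union of the translates chi(phi, u) = phi^* u, for phi in Aut(T_w) and
   u in S. *)
Definition orbit_of (k : fieldType) (w : seq nat) (S : 'rV[k]_22 -> Prop)
    (v : 'rV[k]_22) : Prop :=
  exists (phi : 5.-tuple {mpoly k[5]}) (u : 'rV[k]_22),
    [/\ toric_aut w phi, S u & conic w v = (conic w u) \mPo phi].

(* Subsets of P^n(k) are given by predicates on homogeneous coordinates. *)
Definition vanishes (k : fieldType) (n : nat) (f : {mpoly k[n]})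
    (v : 'rV[k]_n) : Prop :=
  f.@[fun i => v 0 i] = 0.

Definition homogeneous (k : fieldType) (n : nat) (f : {mpoly k[n]}) : Prop :=
  exists d : nat, f \is d.-homog.

(* A nonempty, irreducible, locally closed subset. *)
Definition is_subvariety (k : fieldType) (n : nat) (S : 'rV[k]_n -> Prop) : Prop :=
  [/\ exists v, S v,
      exists I J : {mpoly k[n]} -> Prop,
        (forall f, I f \/ J f -> homogeneous f) /\
        (forall v, S v <->
          [/\ v != 0, forall f, I f -> vanishes f v &
              exists2 f, J f & ~ vanishes f v]) &
      forall f g, homogeneous f -> homogeneous g ->
        (forall v, S v -> vanishes (f * g) v) ->
        (forall v, S v -> vanishes f v) \/ (forall v, S v -> vanishes g v)].

Definition zariski_dense (k : fieldType) (n : nat) (S : 'rV[k]_n -> Prop) : Prop :=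
  forall f : {mpoly k[n]}, homogeneous f ->
    (forall v, S v -> vanishes f v) -> f = 0.

(* Main.v *)
Require Import Defs.
From mathcomp Require Import all_boot all_order all_algebra.
From mathcomp Require Import mpoly ring.
Import GRing.Theory Order.TTheory.
Local Open Scope ring_scope.

Set Implicit Arguments.
Unset Strict Implicit.
Unset Printing Implicit Defensive.

(* Unirationality: on the curve y_1 = 0 the conic bundle becomes the double cover
   z^2 = c_3^2 x_1^2 - 4 a_2 h_2 x_0^2 of P^1, which has a rational point, so the
   bundle has a rational bisection (or a section).  Projecting each conic from the
   point of this bisection parametrizes the bundle after the base change to the
   bisection.  The image is dense because an equation G reduces modulo F to
   R_0 + R_1 y_2; its norm vanishes on algebraically independent coordinates, so
   R_1 <> 0 would make the discriminant of F in y_2 a square and the generic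
   conic singular.

   Density: after completing the square, a conic is given by h, two quadratic forms
   and a binary quadratic form in (y_0, y_1) with quartic coefficients
   q_00, q_01, q_11.  The substitution y_1 -> y_1 + m y_0 and a change of the x_i
   move it into U' as soon as q_00 - m q_01 + m^2 q_11 has a double root N, up to a
   condition on squares that disappears in the Zariski closure.  For varying (m, N)
   the two coefficients of q_00 determined by this condition are algebraically
   independent.

   Algebraic independence is always obtained from linearly independent exponents of
   leading monomials, so that no separability is needed. *)

(** * Polynomials *)

Lemma mmap_comp_mpoly (k : comNzRingType) (S : comNzRingType)
    (iota : {rmorphism k -> S}) (m n : nat) (p : 'I_n -> S)
    (q : m.-tuple {mpoly k[n]}) (F : {mpoly k[m]}) :
  mmap iota p (F \mPo q) = mmap iota (fun i => mmap iota p (tnth q i)) F.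
Proof.
elim/mpolyind: F => [|c M F _ _ IH]; first by rewrite !raddf0.
rewrite !raddfD /= IH; congr (_ + _).
rewrite comp_mpolyZ !mmapZ comp_mpolyX mmapX /mmap1 rmorph_prod /=.
by congr (_ * _); apply: eq_bigr => i _; rewrite rmorphXn.
Qed.

(** Distinct exponents give products of the [tnth h i] with distinct leading monomials, so the
    largest one over the support of [f] cannot cancel. This is the criterion for algebraic
    independence used throughout. *)
Lemma comp_mpoly_inj (R : idomainType) (m n : nat) (h : m.-tuple {mpoly R[n]}) :
  (forall i, tnth h i != 0) ->
  injective (fun e : 'X_{1..m} => (\sum_i mlead (tnth h i) *+ e i)%MM) ->
  forall f : {mpoly R[m]}, f \mPo h = 0 -> f = 0.
Proof.
move=> h_neq0 lead_inj f; apply: contra_eq => f_neq0.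
pose P (e : 'X_{1..m}) := \prod_(i < m) tnth h i ^+ e i.
have P_neq0 e : P e != 0.
  by apply/prodf_neq0 => i _; rewrite expf_neq0.
have leadP e : mlead (P e) = (\sum_i mlead (tnth h i) *+ e i)%MM.
  rewrite /P mlead_prod; last by move=> i _ _; rewrite expf_neq0.
  by apply: eq_bigr => i _; rewrite mleadX.
have [e ef e_max] : exists2 e, e \in msupp f &
    forall e', e' \in msupp f -> (mlead (P e') <= mlead (P e))%O.
  have : msupp f != [::] by rewrite msupp_eq0.
  elim: (msupp f) => // e [|e1 r] IH _.
    by exists e => [|e']; rewrite ?inE // => /eqP ->.
  have [//|e2 e2r max2] := IH; have [le|le] := leP (mlead (P e2)) (mlead (P e)).
    exists e => [|e']; rewrite ?mem_head // inE => /orP[/eqP ->//|/max2].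
    by move=> /le_trans; apply.
  exists e2 => [|e']; rewrite inE ?e2r ?orbT // => /orP[/eqP ->|/max2 //].
  exact: ltW.
apply/eqP => /(congr1 (fun g => g@_(mlead (P e)))) /eqP.
rewrite mcoeff0 comp_mpolyEX raddf_sum /=.
under eq_bigr => e' _ do rewrite comp_mpolyX mcoeffZ -/(P e').
rewrite (bigD1_seq e) ?msupp_uniq //= big_seq_cond big1 ?addr0.
  by rewrite mulf_eq0 mleadc_eq0 (negPf (P_neq0 _)) orbF mcoeff_eq0 ef.
move=> e' /andP[e'f ne]; rewrite [X in _ * X]mcoeff_gt_mlead ?mulr0 //.
have := e_max _ e'f; rewrite le_eqVlt => /orP[/eqP|//].
by rewrite !leadP => /lead_inj /eqP; rewrite (negPf ne).
Qed.

Lemma meval_line (k : comNzRingType) (n : nat) (f : {mpoly k[n]}) (v w : 'I_n -> k) :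
  exists p : {poly k}, forall t, f.@[fun i => v i + t * w i] = p.[t].
Proof.
exists (mmap polyC (fun i => (v i)%:P + 'X * (w i)%:P) f) => t.
elim/mpolyind: f => [|c M f _ _ IH]; first by rewrite !raddf0 horner0.
rewrite !raddfD /= hornerD -IH; congr (_ + _).
rewrite mevalZ mmapZ mevalX mmapX /mmap1 hornerM hornerC horner_prod.
by congr (_ * _); apply: eq_bigr => i _; rewrite horner_exp !hornerE.
Qed.

(** Infinitude of [P] is expressed as escaping every finite list, which yields arbitrarily long
    lists of distinct roots. *)
Lemma poly_eq0_inf (k : fieldType) (P : k -> Prop) (p : {poly k}) :
  (forall s : seq k, exists2 x, x \notin s & P x) ->
  (forall x, P x -> p.[x] = 0) -> p = 0.
Proof.
move=> infP p0; apply/eqP/negPn/negP => p_neq0.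
have root_seq m : exists s : seq k, [/\ size s = m, uniq s & all (root p) s].
  elim: m => [|m [s [sz us rs]]]; first by exists [::].
  have [x xs Px] := infP s; exists (x :: s).
  by rewrite /= sz xs us rs /root p0 ?eqxx.
have [s [sz us rs]] := root_seq (size p).
by have := max_poly_roots p_neq0 rs us; rewrite sz ltnn.
Qed.

Lemma meval_line_eq0 (k : fieldType) (n : nat) (f : {mpoly k[n]}) (v w : 'I_n -> k)
    (P : k -> Prop) :
  (forall s : seq k, exists2 x, x \notin s & P x) ->
  (forall t, P t -> f.@[fun i => v i + t * w i] = 0) ->
  forall t, f.@[fun i => v i + t * w i] = 0.
Proof.
move=> infP fP t; have [p pE] := meval_line f v w.
have -> : f.@[fun i => v i + t * w i] = p.[t] by exact: pE.
have -> : p = 0 by apply: (poly_eq0_inf infP) => x Px; rewrite -pE; apply: fP.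
by rewrite horner0.
Qed.

Lemma infinite_neq0 (k : fieldType) :
  infinite_type k -> forall s : seq k, exists2 x, x \notin s & x != 0.
Proof.
move=> k_inf s; have [x] := k_inf (0 :: s).
by rewrite inE negb_or => /andP[x0 xs]; exists x.
Qed.

Lemma infinite_true (k : fieldType) :
  infinite_type k -> forall s : seq k, exists2 x, x \notin s & True.
Proof. by move=> k_inf s; have [x] := k_inf s; exists x. Qed.

Lemma muniX (R : comNzRingType) (n : nat) (m : 'X_{1..n.+1}) :
  muni 'X_[R, m]
    = ('X_[[multinom (m (widen_ord (leqnSn n) i)) | i < n]])%:P * 'X^(m ord_max).
Proof. by rewrite muniE msuppX big_seq1 mcoeffX eqxx scale1r mul_polyC. Qed.

Lemma muniK (R : comNzRingType) (n : nat) (f : {mpoly R[n.+1]}) :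
  (map_poly (@mwiden n R) (muni f)).['X_ord_max] = f.
Proof.
elim/mpolyind: f => [|c m f _ _ IH]; first by rewrite muni0 map_poly0 horner0.
rewrite muniD.
rewrite [map_poly _ _](rmorphD (map_poly (@mwiden n R))).
rewrite hornerD.
rewrite [X in _ + X = _]IH.
rewrite muniZ.
rewrite muniX.
congr (_ + _).
rewrite -mul_polyC.
rewrite !(rmorphM (map_poly (@mwiden n R))) /= !map_polyC /= map_polyXn !hornerE mwidenC mwidenX.
rewrite -[LHS]/(c%:MP * 'X_[_] * 'X_ord_max ^+ _).
rewrite mul_mpolyC -scalerAl mpolyXn -mpolyXD; congr (_ *: 'X_[_]).
apply/mnmP => i; rewrite mnmDE mulmnE mnm1E.
case: (unliftP ord_max i) => [i'|] ->; last first.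
  by rewrite mnmwiden_ordmax eqxx mul1n.
have -> : lift ord_max i' = widen_ord (leqnSn n) i'.
  by apply/val_inj; rewrite [LHS]lift_max.
rewrite mnmwiden_widen mnmE; case: eqP => [/(congr1 val) /= E|_].
  by have := ltn_ord i'; rewrite -E ltnn.
by rewrite mul0n addn0.
Qed.

Lemma muni_meval (R : comNzRingType) (n : nat) (f : {mpoly R[n.+1]}) v :
  f.@[v] = (map_poly (meval (fun i => v (widen_ord (leqnSn n) i))) (muni f)).[v ord_max].
Proof.
elim/mpolyind: f => [|c m f _ _ IH]; first by rewrite meval0 muni0 map_poly0 horner0.
rewrite mevalD muniD [map_poly _ _](rmorphD (map_poly _)) hornerD.
rewrite [X in _ + X = _]IH muniZ muniX; congr (_ + _).
rewrite -mul_polyC.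
rewrite !(rmorphM (map_poly _)) /=.
rewrite !map_polyC /= map_polyXn !hornerE.
rewrite mevalZ mevalC !mevalX big_ord_recr /= mulrA; congr (_ * _ * _).
by apply: eq_bigr => i _; rewrite mnmE.
Qed.

(** Induction on the number of variables: at fixed values of the first ones, [muni f] becomes a
    univariate polynomial with infinitely many roots. *)
Lemma mpoly_eq0_inf (k : fieldType) (n : nat) (f : {mpoly k[n]}) :
  infinite_type k -> (forall v, f.@[v] = 0) -> f = 0.
Proof.
move=> k_inf.
elim: n f => [|n IH] f f0.
  by have := f0 (fun _ => 0); rewrite [f]nvar0_mpolyC mevalC => ->.
rewrite -[f]muniK; suff -> : muni f = 0 by rewrite map_poly0 horner0.
apply/polyP => j; rewrite coef0; apply: IH => v.
have : map_poly (meval v) (muni f) = 0.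
  apply: (poly_eq0_inf (infinite_true k_inf)) => x _.
  pose w (i : 'I_n.+1) := if unlift ord_max i is Some i' then v i' else x.
  have := f0 w; rewrite muni_meval {2}/w unlift_none => <-; congr (horner _ _).
  apply: eq_map_poly => g; apply: meval_eq => i.
  rewrite /w; case: unliftP => [i'|] E.
    by congr v; apply/val_inj; have := congr1 val E; rewrite [RHS]lift_max.
  by have := congr1 val E => /= En; have := ltn_ord i; rewrite En ltnn.
by move=> /(congr1 (fun p : {poly k} => p`_j)); rewrite coef_map coef0.
Qed.

(** * Conic bundles in T_{2,2,0} *)

Definition form2 (S : comNzRingType) (c : nat -> S) (x y : S) : S :=
  c 0 * x ^+ 2 + c 1 * (x * y) + c 2 * y ^+ 2.

Definition form4 (S : comNzRingType) (c : nat -> S) (x y : S) : S :=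
  c 0 * x ^+ 4 + c 1 * (x ^+ 3 * y) + c 2 * (x ^+ 2 * y ^+ 2)
  + c 3 * (x * y ^+ 3) + c 4 * y ^+ 4.

(** Working over any ring lets one formula cover the polynomial, its values and its images under
    morphisms. The shifts are the positions where the blocks of coefficients of the s_ij start. *)
Definition conicQ (S : comNzRingType) (u : nat -> S) (x0 x1 y0 y1 y2 : S) : S :=
  form4 u x0 x1 * y0 ^+ 2
  + form4 (fun i => u (5 + i)%N) x0 x1 * (y0 * y1)
  + form2 (fun i => u (10 + i)%N) x0 x1 * (y0 * y2)
  + form4 (fun i => u (13 + i)%N) x0 x1 * y1 ^+ 2
  + form2 (fun i => u (18 + i)%N) x0 x1 * (y1 * y2)
  + u 21 * y2 ^+ 2.

Lemma mmap_conic (k : fieldType) (S : comNzRingType) (iota : {rmorphism k -> S})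
    (p : 'I_5 -> S) (v : 'rV[k]_22) :
  mmap iota p (conic [:: 2; 2; 0]%N v)
    = conicQ (fun n => iota (v 0 (inord n))) (p (inord 0)) (p (inord 1))
        (p (inord 2)) (p (inord 3)) (p (inord 4)).
Proof.
rewrite /conic raddf_sum /=.
under eq_bigr => n _ do rewrite mmapZ.
have E (n : 'I_22) : iota (v 0 n) * mmap iota p (conic_basis k [:: 2; 2; 0]%N)`_n
   = iota (v 0 (inord n)) * mmap iota p (conic_basis k [:: 2; 2; 0]%N)`_n.
  by rewrite inord_val.
under eq_bigr => n _ do rewrite E.
rewrite -(big_mkord xpredT (fun n => iota (v 0 (inord n))
   * mmap iota p (conic_basis k [:: 2; 2; 0]%N)`_n)) /=.
rewrite /index_iota /= !big_cons big_nil /=.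
rewrite !(rmorphM, rmorphXn) /= !mmapX !mmap1U.
rewrite /conicQ /form4 /form2 /=.
ring.
Qed.

Lemma conicE (k : fieldType) (v : 'rV[k]_22) :
  conic [:: 2; 2; 0]%N v
    = conicQ (fun n => (v 0 (inord n))%:MP) 'X_(inord 0) 'X_(inord 1)
        'X_(inord 2) 'X_(inord 3) 'X_(inord 4).
Proof.
rewrite -[LHS]comp_mpoly_id.
have /= := mmap_conic (@mpolyC 5 k) (tnth [tuple 'X_i | i < 5]) v.
by rewrite !tnth_mktuple.
Qed.

Lemma mderivXU (R : comNzRingType) (n : nat) (i j : 'I_n) :
  mderiv j ('X_i : {mpoly R[n]}) = (i == j)%:R.
Proof.
rewrite mderivX mnm1E; case: eqP => [->|_]; last by rewrite scale0r.
have -> : (U_(j) - U_(j))%MM = 0%MM :> 'X_{1..n} by apply/mnmP => l; rewrite mnmBE mnm0E subnn.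
by rewrite mpolyX0 scale1r.
Qed.

(** The polarization of [conicQ] in the y_j; the summands stay uncollected to match the Leibniz rule
    literally. *)
Definition polarQ (S : comNzRingType) (u : nat -> S)
    (x0 x1 y0 y1 y2 e0 e1 e2 : S) : S :=
  form4 u x0 x1 * (e0 * y0 + y0 * e0)
  + form4 (fun i => u (5 + i)%N) x0 x1 * (e0 * y1 + y0 * e1)
  + form2 (fun i => u (10 + i)%N) x0 x1 * (e0 * y2 + y0 * e2)
  + form4 (fun i => u (13 + i)%N) x0 x1 * (e1 * y1 + y1 * e1)
  + form2 (fun i => u (18 + i)%N) x0 x1 * (e1 * y2 + y1 * e2)
  + u 21 * (e2 * y2 + y2 * e2).

Lemma rmorph_polarQ (S S' : comNzRingType) (g : {rmorphism S -> S'}) (u : nat -> S)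
    (x0 x1 y0 y1 y2 e0 e1 e2 : S) :
  g (polarQ u x0 x1 y0 y1 y2 e0 e1 e2) =
  polarQ (g \o u) (g x0) (g x1) (g y0) (g y1) (g y2) (g e0) (g e1) (g e2).
Proof. by rewrite /polarQ /form2 /form4 !(rmorphD, rmorphM, rmorphXn). Qed.

Lemma derivation_conicQ (S : comNzRingType) (d : S -> S) (u : nat -> S)
    (x0 x1 y0 y1 y2 : S) :
  {morph d : a b / a + b} -> (forall a b, d (a * b) = d a * b + a * d b) ->
  (forall i, d (u i) = 0) -> d x0 = 0 -> d x1 = 0 ->
  d (conicQ u x0 x1 y0 y1 y2)
    = polarQ u x0 x1 y0 y1 y2 (d y0) (d y1) (d y2).
Proof.
move=> dD dM du dx0 dx1.
by rewrite /conicQ /polarQ /form2 /form4 !exprS !expr0 !mulr1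
  !(dD, dM, du, dx0, dx1, mulr0, mul0r, addr0, add0r).
Qed.

(** * Completing the square and the discriminant of the generic conic *)

Section ConicGeometry.

Variables (k : fieldType) (w : 'rV[k]_22).

Section Forms.
Variables (S : comNzRingType) (iota : k -> S) (x0 x1 : S).

Let u n := iota (w 0 (inord n)).

Definition s00 := form4 u x0 x1.
Definition s01 := form4 (fun i => u (5 + i)%N) x0 x1.
Definition s02 := form2 (fun i => u (10 + i)%N) x0 x1.
Definition s11 := form4 (fun i => u (13 + i)%N) x0 x1.
Definition s12 := form2 (fun i => u (18 + i)%N) x0 x1.
Definition s22 := u 21.

(* [4 s22 F = (2 s22 y2 + s02 y0 + s12 y1)^2
     - (dalpha y0^2 + dbeta y0 y1 + dgamma y1^2)]. *)
Definition dalpha := s02 ^+ 2 - 4 * s22 * s00.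
Definition dbeta := 2 * s02 * s12 - 4 * s22 * s01.
Definition dgamma := s12 ^+ 2 - 4 * s22 * s11.
Definition ddisc := dbeta ^+ 2 - 4 * dalpha * dgamma.

End Forms.

Lemma mmap_conicE (S : comNzRingType) (iota : {rmorphism k -> S}) (p : 'I_5 -> S)
    (x0 := p (inord 0)) (x1 := p (inord 1)) :
  mmap iota p (conic [:: 2; 2; 0]%N w) =
    s00 iota x0 x1 * p (inord 2) ^+ 2
    + s01 iota x0 x1 * (p (inord 2) * p (inord 3))
    + s02 iota x0 x1 * (p (inord 2) * p (inord 4))
    + s11 iota x0 x1 * p (inord 3) ^+ 2
    + s12 iota x0 x1 * (p (inord 3) * p (inord 4))
    + s22 iota * p (inord 4) ^+ 2.
Proof. exact: mmap_conic. Qed.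

Lemma mmap_mderiv_conic (S : comNzRingType) (iota : {rmorphism k -> S})
    (p : 'I_5 -> S) (j : 'I_5) : (2 <= j)%N ->
  let e i := ((inord i : 'I_5) == j)%:R in
  mmap iota p (mderiv j (conic [:: 2; 2; 0]%N w)) =
    polarQ (fun n => iota (w 0 (inord n))) (p (inord 0)) (p (inord 1))
      (p (inord 2)) (p (inord 3)) (p (inord 4)) (e 2) (e 3) (e 4).
Proof.
move=> j2 e; rewrite conicE derivation_conicQ //.
- rewrite (rmorph_polarQ (mmap iota p)) !mderivXU /= !rmorph_nat !mmapX !mmap1U.
  by rewrite /polarQ /form2 /form4 /= !mmapC.
- exact: mderivD.
- exact: mderivM.
- by move=> i; rewrite mderivC.
- by rewrite mderivXU; case: eqP j2 => // <-; rewrite inordK.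
- by rewrite mderivXU; case: eqP j2 => // <-; rewrite inordK.
Qed.

End ConicGeometry.

Section RingMorphism.

Variables (k : fieldType) (w : 'rV[k]_22) (S S' : comNzRingType).
Variables (g : {rmorphism S -> S'}) (f : k -> S) (f' : k -> S') (x0 x1 : S).
Hypothesis gf : forall c, g (f c) = f' c.

Lemma rmorph_s00 : g (s00 w f x0 x1) = s00 w f' (g x0) (g x1).
Proof. by rewrite /s00 /form4 !(rmorphD, rmorphM, rmorphXn) /= !gf. Qed.

Lemma rmorph_s01 : g (s01 w f x0 x1) = s01 w f' (g x0) (g x1).
Proof. by rewrite /s01 /form4 !(rmorphD, rmorphM, rmorphXn) /= !gf. Qed.

Lemma rmorph_s02 : g (s02 w f x0 x1) = s02 w f' (g x0) (g x1).
Proof. by rewrite /s02 /form2 !(rmorphD, rmorphM, rmorphXn) /= !gf. Qed.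

Lemma rmorph_s11 : g (s11 w f x0 x1) = s11 w f' (g x0) (g x1).
Proof. by rewrite /s11 /form4 !(rmorphD, rmorphM, rmorphXn) /= !gf. Qed.

Lemma rmorph_s12 : g (s12 w f x0 x1) = s12 w f' (g x0) (g x1).
Proof. by rewrite /s12 /form2 !(rmorphD, rmorphM, rmorphXn) /= !gf. Qed.

Lemma rmorph_s22 : g (s22 w f) = s22 w f'.
Proof. exact: gf. Qed.

Definition rmorph_s :=
  (rmorph_s00, rmorph_s01, rmorph_s02, rmorph_s11, rmorph_s12, rmorph_s22).

Lemma rmorph_dalpha : g (dalpha w f x0 x1) = dalpha w f' (g x0) (g x1).
Proof. by rewrite /dalpha rmorphB rmorphXn !rmorphM !rmorph_s rmorph_nat. Qed.

Lemma rmorph_dbeta : g (dbeta w f x0 x1) = dbeta w f' (g x0) (g x1).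
Proof. by rewrite /dbeta rmorphB !rmorphM !rmorph_s !rmorph_nat. Qed.

Lemma rmorph_dgamma : g (dgamma w f x0 x1) = dgamma w f' (g x0) (g x1).
Proof. by rewrite /dgamma rmorphB rmorphXn !rmorphM !rmorph_s rmorph_nat. Qed.

Lemma rmorph_ddisc : g (ddisc w f x0 x1) = ddisc w f' (g x0) (g x1).
Proof.
rewrite /ddisc rmorphB rmorphXn !rmorphM rmorph_nat.
by rewrite rmorph_dalpha rmorph_dbeta rmorph_dgamma.
Qed.

End RingMorphism.

Section SmoothGenericFibre.

Variables (k : fieldType) (w : 'rV[k]_22).
Hypotheses (k_char : 2%N \notin [pchar k]) (w_neq0 : w 0 (inord 21) != 0).
Hypothesis w_smooth : smooth_generic_fibre (conic [:: 2; 2; 0]%N w).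

Lemma two_neq0 (L : fieldType) (iota : {rmorphism k -> L}) : 2 != 0 :> L.
Proof.
rewrite -(rmorph_nat iota) fmorph_eq0.
by apply: contra k_char => k2; rewrite inE /= k2.
Qed.

(* The vertex of a degenerate conic is a singular point. *)
Lemma ddisc_neq0 (L : fieldType) (iota : {rmorphism k -> L}) (x : 'I_2 -> L) :
  generic_P1 iota x -> ddisc w iota (x 0) (x 1) != 0.
Proof.
move=> x_gen; apply/negP => /eqP disc0.
have two := two_neq0 iota.
have h_neq0 : s22 w iota != 0 by rewrite /s22 fmorph_eq0.
pose a := dalpha w iota (x 0) (x 1); pose b := dbeta w iota (x 0) (x 1).
pose h := s22 w iota.
pose c := dgamma w iota (x 0) (x 1).
(* [D1] and [D2] put (y0, y1) in the kernel of the degenerate symmetric matrix of the binary form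
   with coefficients a, b, c. *)
have [y0 [y1 [y_neq0 D1 D2]]] : exists y0 y1,
    [/\ (y0 != 0) || (y1 != 0), 2 * a * y0 + b * y1 = 0 & b * y0 + 2 * c * y1 = 0].
  have [a0|a_neq0] := eqVneq a 0.
    exists 1, 0; rewrite oner_eq0 a0 !(mulr0, mulr1, mul0r, addr0); split=> //.
    by apply/eqP; rewrite -sqrf_eq0 -disc0 /ddisc -/a -/b a0 mulr0 mul0r subr0.
  exists b, (- 2 * a); rewrite mulf_neq0 ?oppr_eq0 ?orbT //; split=> //; first by ring.
  by rewrite -disc0 /ddisc -/a -/b -/c; ring.
(* Together with the factors [2 * h] in [q], this makes the completed square vanish without
   division. *)
pose y2 := - (s02 w iota (x 0) (x 1) * y0 + s12 w iota (x 0) (x 1) * y1).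
pose q := nth 0 [:: x 0; x 1; 2 * h * y0; 2 * h * y1; y2].
pose p (i : 'I_5) := q i.
have pE i : (i < 5)%N -> p (inord i) = q i by move=> i5; rewrite /p inordK.
have p_stable : stable p.
  apply/andP; split.
    apply/existsP; exists (inord 0); rewrite pE // inordK //=.
    have := x_gen 1%N 'X_0; rewrite /eval_at mmapX mmap1U; apply.
      by rewrite dhomogX; apply/eqP; exact: mdeg1.
    by rewrite -msupp_eq0 msuppX.
  apply/existsP; case/orP: y_neq0 => y_neq0.
    by exists (inord 2); rewrite pE // inordK //= !mulf_neq0.
  by exists (inord 3); rewrite pE // inordK //= !mulf_neq0.
have pyE : [/\ p (inord 2) = 2 * h * y0, p (inord 3) = 2 * h * y1 & p (inord 4) = y2].
  by rewrite !pE.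
have [py0 py1 py2] := pyE.
have px0 : p (inord 0) = x 0 by rewrite pE.
have px1 : p (inord 1) = x 1 by rewrite pE.
have F0 : eval_at iota p (conic [:: 2; 2; 0]%N w) = 0.
  rewrite /eval_at mmap_conicE px0 px1 py0 py1 py2.
  transitivity (- h / 2 * (y0 * (2 * a * y0 + b * y1) + y1 * (b * y0 + 2 * c * y1))).
    rewrite /y2 /a /b /c /dalpha /dbeta /dgamma -/h; field; exact: two.
  by rewrite D1 D2 !mulr0 addr0 mulr0.
have gen : generic_P1 iota (fun i : 'I_2 => p (widen_ord (isT : (2 <= 5)%N) i)).
  move=> d f fd f0; have := x_gen d f fd f0; rewrite /eval_at.
  have -> // : mmap iota x f = mmap iota (fun i => p (widen_ord (isT : (2 <= 5)%N) i)) f.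
  apply: eq_bigr => m _; congr (_ * _); apply: mmap1_eq => i.
  by case: i => -[|[|//]] lt_i; rewrite /p /=; congr x; apply/val_inj.
have [j j2] := w_smooth p_stable gen F0; apply/negP; rewrite negbK.
rewrite /eval_at mmap_mderiv_conic // px0 px1 py0 py1 py2.
have -> e0 e1 e2 : polarQ (fun n => iota (w 0 (inord n))) (x 0) (x 1)
    (2 * h * y0) (2 * h * y1) y2 e0 e1 e2 = - (2 * a * y0 + b * y1) / 2 * e0
    - (b * y0 + 2 * c * y1) / 2 * e1.
  rewrite /polarQ -/(s00 w iota (x 0) (x 1)) -/(s01 w iota (x 0) (x 1)).
  rewrite -/(s02 w iota (x 0) (x 1)) -/(s11 w iota (x 0) (x 1)).
  rewrite -/(s12 w iota (x 0) (x 1)) -/(s22 w iota) -/h.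
  by rewrite /y2 /a /b /c /dalpha /dbeta /dgamma -/h; field.
by rewrite D1 D2 oppr0 !mul0r subrr.
Qed.
End SmoothGenericFibre.

Lemma muniXU_widen (R : comNzRingType) (n : nat) (i : 'I_n) :
  muni ('X_(widen_ord (leqnSn n) i) : {mpoly R[n.+1]}) = ('X_i)%:P.
Proof.
rewrite muniX mnm1E; case: eqP => [/(congr1 val) /= E|_].
  by have := ltn_ord i; rewrite E ltnn.
rewrite expr0 mulr1; congr (_%:P); congr 'X_[_]; apply/mnmP => j.
by rewrite mnmE !mnm1E; congr (nat_of_bool _); apply/eqP/eqP => [|->//];
  move=> /(congr1 val) /= E; apply/val_inj.
Qed.

Lemma muniXU_max (R : comNzRingType) (n : nat) :
  muni ('X_ord_max : {mpoly R[n.+1]}) = 'X.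
Proof.
rewrite muniX mnm1E eqxx expr1 (_ : [multinom _ | _ < _] = 0%MM) ?mpolyX0 ?mul1r //.
apply/mnmP => j; rewrite mnmE mnm1E mnm0E; case: eqP => // /(congr1 val) /= E.
by have := ltn_ord j; rewrite -E ltnn.
Qed.

Lemma eval_tofrac (k : fieldType) (m n : nat) (h : m.-tuple {mpoly k[n]})
    (f : {mpoly k[m]}) :
  eval_at (fun c => tofrac (mpolyC n c)) (fun i => tofrac (tnth h i)) f
    = tofrac (f \mPo h).
Proof.
rewrite /eval_at -[LHS]/(mmap (@tofrac _ \o @mpolyC n k) (fun i => tofrac (tnth h i)) f).
elim/mpolyind: f => [|c M f _ _ IH]; first by rewrite mmap0 comp_mpoly0 tofrac0.
rewrite mmapD IH comp_mpolyD tofracD mmapZ mmapX comp_mpolyZ comp_mpolyX.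
rewrite -mul_mpolyC tofracM rmorph_prod /=; congr (_ * _ + _).
by apply: eq_bigr => i _; rewrite tofracXn.
Qed.

Lemma generic_tofrac (k : fieldType) (n : nat) (h : 2.-tuple {mpoly k[n]}) :
  (forall f : {mpoly k[2]}, f \mPo h = 0 -> f = 0) ->
  generic_P1 (fun c => tofrac (mpolyC n c)) (fun i => tofrac (tnth h i)).
Proof.
move=> h_inj d f _ f_neq0; rewrite eval_tofrac tofrac_eq0.
by apply: contra f_neq0 => /eqP /h_inj ->.
Qed.

(** [R] divides [M], so the quadratic polynomial is itself the square of some [T] of degree at most
    one; compare coefficients. *)
Lemma quadratic_square_disc (F : fieldType) (a b c : F) (M R : {poly F}) :
  R != 0 -> M ^+ 2 = R ^+ 2 * (a%:P + b%:P * 'X + c%:P * 'X ^+ 2) ->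
  b ^+ 2 = 4 * a * c.
Proof.
move=> R_neq0 E.
have /dvdpP[T TE] : R %| M by rewrite -(dvdp_pexp2r R M (isT : (0 < 2)%N)) E dvdp_mulr.
have T2 : T ^+ 2 = a%:P + b%:P * 'X + c%:P * 'X ^+ 2.
  have R2 : R ^+ 2 != 0 by rewrite expf_neq0.
  by apply: (mulfI R2); rewrite -E TE exprMn mulrC.
have size_T : (size T <= 2)%N.
  have : (size (T ^+ 2) <= 3)%N.
    rewrite T2; apply/leq_sizeP => j; case: j => [|[|[|j]]] // _.
    by rewrite !coefE /= !mulr0 !addr0.
  have := size_exp T 2; move: (size (T ^+ 2)) => n.
  by case: (size T) => [|[|[|m]]] //; case: n => [|[|[|[|n]]]].
have TX : T = (T`_0)%:P + (T`_1)%:P * 'X.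
  apply/polyP => -[|[|j]]; rewrite !coefE /= ?mulr1 ?mulr0 ?addr0 ?add0r //.
  by move/leq_sizeP: size_T; apply.
have coefT : T ^+ 2 = (T`_0 ^+ 2)%:P + (2 * T`_0 * T`_1)%:P * 'X + (T`_1 ^+ 2)%:P * 'X^2.
  by rewrite {1}TX !rmorphXn !rmorphM /= rmorph_nat; ring.
have coefE j : (a%:P + b%:P * 'X + c%:P * 'X^2)`_j =
    ((T`_0 ^+ 2)%:P + (2 * T`_0 * T`_1)%:P * 'X + (T`_1 ^+ 2)%:P * 'X^2)`_j.
  by rewrite -T2 coefT.
have := (coefE 0, coefE 1, coefE 2); rewrite !poly.coefE /= !(mulr0, mulr1, addr0, add0r).
by move=> [[-> ->] ->]; ring.
Qed.

Lemma quadratic_form_square_disc (F : fieldType) (a b c z : F) (M R : {poly F}) :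
  R != 0 -> z != 0 ->
  M ^+ 2 = R ^+ 2 * (a%:P * z%:P ^+ 2 + b%:P * (z%:P * 'X) + c%:P * 'X ^+ 2) ->
  b ^+ 2 - 4 * a * c = 0.
Proof.
move=> R_neq0 z_neq0 E.
have disc0 : (b * z) ^+ 2 = 4 * (a * z ^+ 2) * c.
  apply: (quadratic_square_disc (M := M) R_neq0); rewrite E; congr (_ * (_ + _ + _)).
    by rewrite polyCM polyC_exp.
  by rewrite polyCM mulrA.
have z2_neq0 : z ^+ 2 != 0 by rewrite expf_neq0.
apply: (mulfI z2_neq0); rewrite mulr0 mulrBr -exprMn [z * b]mulrC disc0.
by apply/eqP; rewrite subr_eq0; apply/eqP; ring.
Qed.

Section NonSquare.

Variables (k : fieldType) (w : 'rV[k]_22).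
Hypotheses (k_char : 2%N \notin [pchar k]) (w_neq0 : w 0 (inord 21) != 0).
Hypothesis w_smooth : smooth_generic_fibre (conic [:: 2; 2; 0]%N w).

Let X i : {mpoly k[4]} := 'X_(inord i).
Let C := @mpolyC 4 k.

(** As a polynomial in [X 3] over the fraction field in the other variables, the form has nonzero
    discriminant, because ('X_0 : 'X_1) is a generic point of P^1. *)
Lemma disc_form_nonsquare (M R : {mpoly k[4]}) : R != 0 ->
  M ^+ 2 = R ^+ 2 * (dalpha w C (X 0) (X 1) * X 2 ^+ 2
    + dbeta w C (X 0) (X 1) * (X 2 * X 3) + dgamma w C (X 0) (X 1) * X 3 ^+ 2) -> False.
Proof.
move=> R_neq0 E.
pose T := {fraction {mpoly k[3]}}.
pose iota : {rmorphism k -> T} := @tofrac _ \o @mpolyC 3 k.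
pose theta : {rmorphism {mpoly k[4]} -> {poly T} } := map_poly (@tofrac _) \o @muni 3 k.
have thetaX (i : 'I_3) : theta (X i) = (tofrac 'X_i)%:P.
  have -> : X i = 'X_(widen_ord (leqnSn 3) i).
    by congr 'X_[U_(_)]; apply/val_inj; rewrite /= inordK // ltnS ltnW.
  by rewrite /theta /= muniXU_widen map_polyC.
have thetaX3 : theta (X 3) = 'X.
  have -> : X 3 = 'X_ord_max by congr 'X_[U_(_)]; apply/val_inj; rewrite /= inordK .
  by rewrite /theta /= muniXU_max map_polyX.
have thetaC c : theta (C c) = (iota c)%:P by rewrite /theta /= muniC map_polyC.
(* The three coefficients of the form commute with ring morphisms; a general [D] treats them
   together. *)
have thetaD (D : 'rV[k]_22 -> forall S : comNzRingType, (k -> S) -> S -> S -> S) :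
  (forall (S S' : comNzRingType) (g : {rmorphism S -> S'}) (f : k -> S) (f' : k -> S')
     (x0 x1 : S), (forall c, g (f c) = f' c) ->
     g (D w S f x0 x1) = D w S' f' (g x0) (g x1)) ->
  theta (D w _ C (X 0) (X 1)) = (D w _ iota (tofrac 'X_0) (tofrac 'X_1))%:P.
  move=> rmorphD; rewrite (rmorphD _ _ theta C (polyC \o iota) _ _ thetaC).
  rewrite (thetaX 0) (thetaX 1); apply/esym.
  exact: (rmorphD _ _ (@polyC T) iota).
have thetaR : theta R != 0.
  apply: contra R_neq0 => /eqP R0; rewrite -[R]muniK; apply/eqP.
  suff -> : muni R = 0 by rewrite map_poly0 horner0.
  apply/polyP => j; rewrite coef0; apply/eqP; rewrite -tofrac_eq0.
  by have := congr1 (fun p : {poly T} => p`_j) R0; rewrite /theta /= coef_map coef0 => ->.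
have := congr1 theta E; rewrite rmorphXn [theta (_ * _)]rmorphM rmorphXn.
rewrite !(rmorphD theta) [theta (_ * X 2 ^+ 2)]rmorphM [theta (_ * X 3 ^+ 2)]rmorphM
  !(rmorphXn theta) !(rmorphM theta).
rewrite (thetaD (fun w => @dalpha k w)); last exact: rmorph_dalpha.
rewrite (thetaD (fun w => @dbeta k w)); last exact: rmorph_dbeta.
rewrite (thetaD (fun w => @dgamma k w)); last exact: rmorph_dgamma.
rewrite (thetaX 2) thetaX3.
have X2_neq0 : tofrac 'X_2 != 0 :> T by rewrite tofrac_eq0 -msupp_eq0 msuppX.
move=> /(quadratic_form_square_disc thetaR X2_neq0) disc0.
pose h := [tuple ('X_(widen_ord (isT : (2 <= 3)%N) i) : {mpoly k[3]}) | i < 2].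
have h_gen : generic_P1 iota (fun i => tofrac (tnth h i)).
  apply: generic_tofrac; apply: comp_mpoly_inj => [i|e e' /mnmP E2].
    by rewrite tnth_mktuple -msupp_eq0 msuppX.
  apply/mnmP => i; have := E2 (widen_ord (isT : (2 <= 3)%N) i).
  rewrite !mnm_sumE; under eq_bigr do rewrite tnth_mktuple mleadXm mulmnE mnm1E.
  under [RHS]eq_bigr do rewrite tnth_mktuple mleadXm mulmnE mnm1E.
  rewrite (bigD1 i) //= big1 => [|j ji]; last first.
    by rewrite -val_eqE /= val_eqE (negPf ji).
  rewrite [RHS](bigD1 i) //= [X in _ = (_ + X)%N -> _]big1 => [|j ji]; last first.
    by rewrite -val_eqE /= val_eqE (negPf ji).
  by rewrite !eqxx !mul1n !addn0.
have := ddisc_neq0 k_char w_neq0 w_smooth h_gen.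
rewrite !tnth_mktuple => /eqP; apply; rewrite -[RHS]disc0.
have -> : widen_ord (isT : (2 <= 3)%N) 0 = 0 by apply/val_inj.
by have -> : widen_ord (isT : (2 <= 3)%N) 1 = 1 by apply/val_inj.
Qed.

End NonSquare.

(** * Unirationality *)

Lemma eq_mmap (k S : nzRingType) (n : nat) (iota : k -> S) (p q : 'I_n -> S)
    (f : {mpoly k[n]}) : p =1 q -> mmap iota p f = mmap iota q f.
Proof. by move=> pq; apply: eq_bigr => m _; rewrite (mmap1_eq _ pq). Qed.

Section Reduction.

(* [Y2] says that [F] is quadratic in [Y], with lower coefficients [wd s] and
   [wd q] and with leading coefficient inverse to [wd hi]. *)
Variables (A S : comNzRingType) (wd : {rmorphism A -> S}) (F Y : S) (hi s q : A).
Hypothesis Y2 : Y ^+ 2 = wd hi * (F - wd s * Y - wd q).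

(** Division by [F] with remainder of degree at most one in [Y], phrased as a property stable under
    sums and products, so that checking generators is enough. *)
Definition reducible (G : S) : Prop :=
  exists (H : S) (R0 R1 : A), G = F * H + wd R0 + wd R1 * Y.

Lemma reducible_base (a : A) : reducible (wd a).
Proof. by exists 0, a, 0; rewrite rmorph0; ring. Qed.

Lemma reducible_var : reducible Y.
Proof. by exists 0, 0, 1; rewrite rmorph0 rmorph1; ring. Qed.

Lemma reducibleD G G' : reducible G -> reducible G' -> reducible (G + G').
Proof.
move=> [H [R0 [R1 ->]]] [H' [R0' [R1' ->]]].
by exists (H + H'), (R0 + R0'), (R1 + R1'); rewrite !rmorphD; ring.
Qed.

Lemma reducibleM G G' : reducible G -> reducible G' -> reducible (G * G').
Proof.
move=> [H [R0 [R1 ->]]] [H' [R0' [R1' ->]]].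
exists (H * (F * H' + wd R0' + wd R1' * Y) + (wd R0 + wd R1 * Y) * H'
        + wd R1 * wd R1' * wd hi),
  (R0 * R0' - hi * (R1 * R1') * q), (R0 * R1' + R1 * R0' - hi * (R1 * R1') * s).
apply/eqP; rewrite -subr_eq0; apply/eqP.
transitivity (wd R1 * wd R1' * (Y ^+ 2 - wd hi * (F - wd s * Y - wd q))); first by ring.
by rewrite Y2 subrr mulr0.
Qed.

End Reduction.

Section Unirationality.

Variables (k : fieldType) (w : 'rV[k]_22).
Hypotheses (k_char : 2%N \notin [pchar k]) (w_neq0 : w 0 (inord 21) != 0).
Hypothesis w_smooth : smooth_generic_fibre (conic [:: 2; 2; 0]%N w).

Let C4 := @mpolyC 4 k.
Let X i : {mpoly k[4]} := 'X_(inord i).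
Let wd_tuple := [tuple ('X_(widen_ord (leqnSn 4) i) : {mpoly k[5]}) | i < 4].
Let h := w 0 (inord 21).
Let F := conic [:: 2; 2; 0]%N w.

Let lin : {mpoly k[4]} :=
  s02 w C4 (X 0) (X 1) * X 2 + s12 w C4 (X 0) (X 1) * X 3.
Let quad : {mpoly k[4]} :=
  s00 w C4 (X 0) (X 1) * X 2 ^+ 2 + s01 w C4 (X 0) (X 1) * (X 2 * X 3)
  + s11 w C4 (X 0) (X 1) * X 3 ^+ 2.

Let wd : {rmorphism {mpoly k[4]} -> {mpoly k[5]} } := comp_mpoly wd_tuple.

Lemma wdX i : (i < 4)%N -> wd (X i) = 'X_(inord i).
Proof.
move=> lt_i; rewrite /wd /X /= comp_mpolyXU -tnth_nth tnth_mktuple.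
by congr 'X_[U_(_)]; apply/val_inj; rewrite /= !inordK // ltnW.
Qed.

Lemma conic_quadratic : F = wd quad + wd lin * 'X_(inord 4) + h%:MP * 'X_(inord 4) ^+ 2.
Proof.
have wdC c : wd (C4 c) = mpolyC 5 c by rewrite /wd /= comp_mpolyC.
rewrite /F conicE /quad /lin !(rmorphD wd) !(rmorphM wd).
rewrite (rmorph_s00 w (X 0) (X 1) wdC) (rmorph_s01 w (X 0) (X 1) wdC).
rewrite (rmorph_s02 w (X 0) (X 1) wdC) (rmorph_s11 w (X 0) (X 1) wdC).
rewrite (rmorph_s12 w (X 0) (X 1) wdC) !wdX //.
rewrite /conicQ /s00 /s01 /s02 /s11 /s12 /h.
set f00 := form4 _ _ _; set f01 := form4 _ _ _; set f11 := form4 _ _ _.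
set f02 := form2 _ _ _; set f12 := form2 _ _ _.
by ring.
Qed.

(** The coefficient of y_2^2 is the nonzero constant [h], so no denominators in the other variables
    arise. *)
Lemma conic_division (G : {mpoly k[5]}) : exists H (R0 R1 : {mpoly k[4]}),
  G = F * H + wd R0 + wd R1 * 'X_(inord 4).
Proof.
have Y2 : 'X_(inord 4) ^+ 2 = wd (h^-1)%:MP * (F - wd lin * 'X_(inord 4) - wd quad).
  have -> : wd (h^-1)%:MP = (h^-1)%:MP by rewrite /wd /= comp_mpolyC.
  rewrite conic_quadratic; set Y := 'X_(inord 4); set a := wd quad; set b := wd lin * Y.
  have -> : a + b + h%:MP * Y ^+ 2 - b - a = h%:MP * Y ^+ 2 by ring.
  by rewrite mulrA -mpolyCM mulVf // mpolyC1 mul1r.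
have RX (i : 'I_5) : reducible wd F 'X_(inord 4) 'X_i.
  have [i4|i4] := ltnP i 4.
    have -> : 'X_i = wd (X i) by rewrite wdX // inord_val.
    exact: reducible_base.
  have -> : i = inord 4.
    by apply/val_inj; rewrite /= inordK //; apply/eqP; rewrite eqn_leq i4 -ltnS ltn_ord.
  exact: reducible_var.
have RC c : reducible wd F 'X_(inord 4) c%:MP.
  have -> : c%:MP = wd c%:MP by rewrite /wd /= comp_mpolyC.
  exact: reducible_base.
elim/mpolyind: G => [|c m G _ _ IH]; first by rewrite -[0]/(0%:MP); apply: RC.
apply: reducibleD IH; rewrite -mul_mpolyC; apply: (reducibleM Y2 (RC c)).
rewrite ['X_[m]]mpolyXE_id; elim/big_ind: _ => [||i _].
- exact: (RC 1).
- by move=> G1 G2; apply: (reducibleM Y2).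
elim: (m i) => [|n IH]; first exact: (RC 1).
by rewrite exprS; apply: (reducibleM Y2).
Qed.

Lemma lin_quad_disc : lin ^+ 2 - 4 * h%:MP * quad =
  dalpha w C4 (X 0) (X 1) * X 2 ^+ 2 + dbeta w C4 (X 0) (X 1) * (X 2 * X 3)
  + dgamma w C4 (X 0) (X 1) * X 3 ^+ 2.
Proof.
rewrite /dalpha /dbeta /dgamma -[s22 w C4]/(h%:MP) /lin /quad.
set S00 := s00 _ _ _ _; set S01 := s01 _ _ _ _; set S02 := s02 _ _ _ _.
set S11 := s11 _ _ _ _; set S12 := s12 _ _ _ _.
by ring.
Qed.

(** [F] is quadratic in y_2, so the first four coordinates control dominance: their independence
    kills both coefficients of the remainder of any [G] vanishing at the point. *)
Lemma unirational_of_point (P : 5.-tuple {mpoly k[4]}) :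
  F \mPo P = 0 ->
  (forall f : {mpoly k[4]},
     f \mPo [tuple tnth P (widen_ord (leqnSn 4) i) | i < 4] = 0 -> f = 0) ->
  unirational [:: 2; 2; 0]%N F.
Proof.
move=> FP; set P4 := [tuple _ | i < 4] => P4_inj.
exists 4, (fun i => tofrac (tnth P i)).
have P_neq0 (i : 'I_4) : tnth P (widen_ord (leqnSn 4) i) != 0.
  have : 'X_i != 0 :> {mpoly k[4]} by rewrite -msupp_eq0 msuppX.
  apply: contraNneq => Pi0; apply/eqP; apply: P4_inj.
  by rewrite comp_mpolyXU -tnth_nth tnth_mktuple.
split.
- apply/andP; split; apply/existsP.
    exists (widen_ord (leqnSn 4) 0); rewrite /= tofrac_eq0; exact: P_neq0.
  by exists (widen_ord (leqnSn 4) (inord 2)); rewrite /= inordK // tofrac_eq0 P_neq0.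
- by rewrite eval_tofrac FP tofrac0.
move=> b G _; rewrite eval_tofrac => /eqP; rewrite tofrac_eq0 => /eqP GP L iota p _ Fp.
have [H [R0 [R1 GE]]] := conic_division G.
have wdP R : wd R \mPo P = R \mPo P4.
  rewrite /wd /= /comp_mpoly mmap_comp_mpoly; apply: eq_mmap => i.
  by rewrite !tnth_mktuple mmapX mmap1U.
pose g : {rmorphism {mpoly k[5]} -> {mpoly k[4]} } := comp_mpoly P.
pose g4 : {rmorphism {mpoly k[4]} -> {mpoly k[4]} } := comp_mpoly P4.
have {}wdP R : g (wd R) = g4 R by exact: wdP.
pose Y := g 'X_(inord 4).
have GY : g4 R0 + g4 R1 * Y = 0.
  have gF : g F = 0 by exact: FP.
  rewrite -!wdP /Y -[RHS]GP -[RHS]/(g G) GE !(rmorphD g) !(rmorphM g).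
  by rewrite gF mul0r add0r.
have FY : g4 quad + g4 lin * Y + h%:MP * Y ^+ 2 = 0.
  rewrite -[RHS]FP conic_quadratic -[RHS]/(g _) !(rmorphD g) !(rmorphM g) !wdP.
  by rewrite [g h%:MP]comp_mpolyC expr2.
(* This is [h] times the norm of R_0 + R_1 y_2, for y_2 a root of [F]. *)
have N0 : h%:MP * R0 ^+ 2 - lin * R0 * R1 + quad * R1 ^+ 2 = 0.
  apply: P4_inj; rewrite -[LHS]/(g4 _) rmorphD rmorphB !rmorphM /=.
  rewrite [comp_mpoly _ h%:MP]comp_mpolyC -/(g4 R0) -/(g4 R1) -/(g4 lin) -/(g4 quad).
  have -> : g4 R0 = - (g4 R1 * Y) by apply/eqP; rewrite -addr_eq0 GY.
  transitivity (g4 R1 ^+ 2 * (g4 quad + g4 lin * Y + h%:MP * Y ^+ 2)); first by ring.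
  by rewrite FY mulr0.
have R1_0 : R1 = 0.
  apply/eqP/negPn/negP => R1_neq0.
  (* Multiplied by 4 h, [N0] reads (2 h R_0 - lin R_1)^2 = R_1^2 (lin^2 - 4 h quad). *)
  apply: (disc_form_nonsquare k_char w_neq0 w_smooth (M := 2 * h%:MP * R0 - lin * R1) R1_neq0).
  rewrite -lin_quad_disc; apply/eqP; rewrite -subr_eq0; apply/eqP.
  transitivity (4 * h%:MP * (h%:MP * R0 ^+ 2 - lin * R0 * R1 + quad * R1 ^+ 2)); first by ring.
  by rewrite N0 mulr0.
have R0_0 : R0 = 0.
  apply: P4_inj; have := GY; rewrite R1_0 rmorph0 mul0r addr0; exact.
rewrite GE R0_0 R1_0 !rmorph0 mul0r !addr0 /eval_at rmorphM /=.
by rewrite [mmap iota p F]Fp mul0r.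
Qed.

End Unirationality.

(** * Leading monomials and projection from a bisection *)

Lemma mnm_le_mdeg (n : nat) (m : 'X_{1..n}) (i : 'I_n) : (m i <= mdeg m)%N.
Proof. by rewrite mdegE (bigD1 i) //= leq_addr. Qed.

Lemma mdeg_mlead_le (R : nzRingType) (n : nat) (p : {mpoly R[n]}) :
  (mdeg (mlead p) <= msize p)%N.
Proof.
have [->|p_neq0] := eqVneq p 0; first by rewrite mlead0 mdeg0.
by rewrite -mlead_deg.
Qed.

Lemma msizeXn (R : nzRingType) (n W : nat) (i : 'I_n) :
  msize ('X_i ^+ W : {mpoly R[n]}) = W.+1.
Proof. by rewrite mpolyXn msizeX mdegMn mdeg1 mul1n. Qed.

Lemma msizeD_Xn_le (R : idomainType) (n W : nat) (i : 'I_n) (p q : {mpoly R[n]}) :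
  (msize p < W)%N -> (msize (p + q * 'X_i ^+ W) <= msize q + W)%N.
Proof.
move=> pW; apply: leq_trans (msizeD_le _ _) _; rewrite geq_max.
rewrite (leq_trans (ltnW pW)) ?leq_addl //=.
have [->|q_neq0] := eqVneq q 0; first by rewrite mul0r msize0.
by rewrite msizeM // ?expf_neq0 -?msupp_eq0 ?msuppX // msizeXn addnS.
Qed.

Lemma addXn_neq0 (R : idomainType) (n W : nat) (i : 'I_n) (p q : {mpoly R[n]}) :
  (msize p < W)%N -> (p != 0) || (q != 0) -> p + q * 'X_i ^+ W != 0.
Proof.
move=> pW pq; have [q0|q_neq0] := eqVneq q 0.
  by move: pq; rewrite q0 eqxx orbF mul0r addr0.
rewrite addr_eq0; apply/eqP => pE; move: pW; rewrite pE msizeN.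
rewrite msizeM // ?expf_neq0 -?msupp_eq0 ?msuppX // msizeXn addnS /=.
by rewrite ltnNge leq_addl.
Qed.

(** Cramer's rule, carried out over the integers to allow subtraction; it recovers exponents from a
    2 by 2 block of leading monomials. *)
Lemma linear_system2_inj (a b c d e f e' f' : nat) : (a * d != b * c)%N ->
  (a * e + c * f = a * e' + c * f')%N -> (b * e + d * f = b * e' + d * f')%N ->
  e = e' /\ f = f'.
Proof.
move=> det E1 E2.
have det' : a%:Z * d%:Z - b%:Z * c%:Z != 0 by rewrite subr_eq0 -!PoszM eqz_nat.
have {}E1 : a%:Z * (e%:Z - e'%:Z) + c%:Z * (f%:Z - f'%:Z) = 0.
  transitivity (a%:Z * e%:Z + c%:Z * f%:Z - (a%:Z * e'%:Z + c%:Z * f'%:Z)); first by ring.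
  by rewrite -!PoszM -!PoszD E1 subrr.
have {}E2 : b%:Z * (e%:Z - e'%:Z) + d%:Z * (f%:Z - f'%:Z) = 0.
  transitivity (b%:Z * e%:Z + d%:Z * f%:Z - (b%:Z * e'%:Z + d%:Z * f'%:Z)); first by ring.
  by rewrite -!PoszM -!PoszD E2 subrr.
have ee : (a%:Z * d%:Z - b%:Z * c%:Z) * (e%:Z - e'%:Z) = 0.
  transitivity (d%:Z * 0 - c%:Z * 0); last by ring.
  by rewrite -{1}E1 -{1}E2; ring.
have ff : (a%:Z * d%:Z - b%:Z * c%:Z) * (f%:Z - f'%:Z) = 0.
  transitivity (a%:Z * 0 - b%:Z * 0); last by ring.
  by rewrite -{1}E2 -{1}E1; ring.
move/eqP: ee; rewrite mulf_eq0 (negPf det') /= subr_eq0 => /eqP [->].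
by move/eqP: ff; rewrite mulf_eq0 (negPf det') /= subr_eq0 => /eqP [->].
Qed.

Section Parametrization.

Variables (k : fieldType) (w : 'rV[k]_22).
Hypotheses (k_char : 2%N \notin [pchar k]) (w_neq0 : w 0 (inord 21) != 0).
Hypothesis w_smooth : smooth_generic_fibre (conic [:: 2; 2; 0]%N w).

Let C4 := @mpolyC 4 k.
Let F := conic [:: 2; 2; 0]%N w.

Variables (x0 x1 p : {mpoly k[4]}).
Hypotheses (x0_neq0 : x0 != 0) (x1_neq0 : x1 != 0).
Hypothesis x_lead : (mlead x0 (inord 0) * mlead x1 (inord 1)
                    != mlead x0 (inord 1) * mlead x1 (inord 0))%N.
Hypothesis x_lead0 : [/\ mlead x0 (inord 2) = 0, mlead x0 (inord 3) = 0,
  mlead x1 (inord 2) = 0 & mlead x1 (inord 3) = 0]%N.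
Hypothesis section_p :
  s00 w C4 x0 x1 + s02 w C4 x0 x1 * p + s22 w C4 * p ^+ 2 = 0.

(** The conic over (x0 : x1) contains O = (1 : 0 : p). The line through O and D = (0 : 1 : V) meets
    it again at q O - b D, where q is the value at D and b the polar of O and D. Here V is a power
    of [U], and [mu] is the homogeneous scaling. *)
Lemma unirational_of_bisection : unirational [:: 2; 2; 0]%N F.
Proof.
pose b0 := s01 w C4 x0 x1 + s12 w C4 x0 x1 * p.
pose b1 := s02 w C4 x0 x1 + 2 * s22 w C4 * p.
have disc_neq0 : ddisc w C4 x0 x1 != 0.
  pose h := [tuple x0; x1].
  have h_gen : generic_P1 (@tofrac _ \o C4) (fun i => tofrac (tnth h i)).
    apply: generic_tofrac; apply: comp_mpoly_inj => [|e e' /mnmP E].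
      by case=> -[|[|//]] lt_i; rewrite (tnth_nth 0).
    have {}E j : (mlead x0 j * e 0%R + mlead x1 j * e 1%R
        = mlead x0 j * e' 0%R + mlead x1 j * e' 1%R)%N.
      have := E j; rewrite !mnm_sumE !big_ord_recl !big_ord0 !mulmnE !(tnth_nth 0) /= !addn0.
      by have -> : lift ord0 ord0 = 1 :> 'I_2 by apply/val_inj.
    have [e0 e1] := linear_system2_inj x_lead (E (inord 0)) (E (inord 1)).
    apply/mnmP; case=> -[|[|//]] lt_i.
      by have -> : Ordinal lt_i = 0 by apply/val_inj.
    by have -> : Ordinal lt_i = 1 by apply/val_inj.
  have := ddisc_neq0 k_char w_neq0 w_smooth h_gen; rewrite !(tnth_nth 0) /=.
  rewrite -(rmorph_ddisc (g := @tofrac _) w _ _ (f := C4)) ?tofrac_eq0 //.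
(* If both vanish, O is a singular point of the conic, contrary to the nonzero discriminant. *)
have b_neq0 : (b0 != 0) || (b1 != 0).
  apply: contraNT disc_neq0; rewrite negb_or !negbK => /andP[/eqP b0_0 /eqP b1_0].
  rewrite /ddisc; have -> : dalpha w C4 x0 x1 = 0.
    transitivity (b1 ^+ 2 - 4 * s22 w C4 *
        (s00 w C4 x0 x1 + s02 w C4 x0 x1 * p + s22 w C4 * p ^+ 2)).
      by rewrite /dalpha /b1; ring.
    by rewrite section_p b1_0; ring.
  have -> : dbeta w C4 x0 x1 = 0.
    transitivity (2 * s12 w C4 x0 x1 * b1 - 4 * s22 w C4 * b0).
      by rewrite /dbeta /b1 /b0; ring.
    by rewrite b0_0 b1_0; ring.
  by apply/eqP; ring.
pose q0 := s11 w C4 x0 x1; pose q1 := s12 w C4 x0 x1; pose h := s22 w C4.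
(* [W] exceeds the degrees of all four coefficients, so powers of [U ^+ W] prevent cancellation and
   make the leading monomial of [q] explicit. *)
pose W := (msize q0 + msize q1 + msize b0 + msize b1).+1.
pose U : {mpoly k[4]} := 'X_(inord 2); pose mu : {mpoly k[4]} := 'X_(inord 3).
pose q := q0 + q1 * U ^+ W + h * U ^+ (2 * W); pose b := b0 + b1 * U ^+ W.
pose P := [tuple x0; x1; mu * q; - (mu * b); mu * (q * p - b * U ^+ W)].
have tP i : (i < 5)%N -> tnth P (inord i) = nth 0 P i.
  by move=> i5; rewrite (tnth_nth 0) inordK.
apply: (unirational_of_point k_char w_neq0 w_smooth (P := P)).
  rewrite /comp_mpoly mmap_conicE !tP //=.
  rewrite -/C4; move: section_p; rewrite /q /b /b0 /b1 /q0 /q1 -/h.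
  set S00 := s00 _ _ _ _; set S01 := s01 _ _ _ _; set S02 := s02 _ _ _ _.
  set S11 := s11 _ _ _ _; set S12 := s12 _ _ _ _ => sp.
  rewrite mul2n -addnn exprD; move: (U ^+ W) => V.
  transitivity (mu ^+ 2 * (S11 + S12 * V + h * (V * V)) ^+ 2 * (S00 + S02 * p + h * p ^+ 2)).
    by ring.
  by rewrite sp mulr0.
have h_neq0 : h != 0 by rewrite /h /s22 mpolyC_eq0.
have U_neq0 : U != 0 by rewrite -msupp_eq0 msuppX.
have mu_neq0 : mu != 0 by rewrite -msupp_eq0 msuppX.
have [W0 W1 Wb0 Wb1] : [/\ msize q0 < W, msize q1 < W, msize b0 < W & msize b1 < W]%N.
  rewrite /W; split; rewrite ltnS -!addnA.
  - exact: leq_addr.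
  - by rewrite addnCA leq_addr.
  - by rewrite addnA addnCA leq_addr.
  - by rewrite !addnA leq_addl.
have lead_hU : mlead (h * U ^+ (2 * W)) = (U_(inord 2) *+ (2 * W))%MM.
  by rewrite mleadM ?expf_neq0 // mleadX // mleadC mleadXm add0m.
have lt_q : (mlead (q0 + q1 * U ^+ W) < mlead (h * U ^+ (2 * W)))%O.
  apply: lt_mdeg_ltmc; rewrite lead_hU mdegMn mdeg1 mul1n.
  apply: leq_ltn_trans (mdeg_mlead_le _) _.
  by apply: leq_ltn_trans (msizeD_Xn_le _ _ W0) _; rewrite mul2n -addnn ltn_add2r.
have lead_q : mlead q = (U_(inord 2) *+ (2 * W))%MM by rewrite /q mleadDr.
have q_neq0 : q != 0.
  apply/eqP => q_0; have := congr1 mdeg lead_q.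
  by rewrite q_0 mlead0 mdeg0 mdegMn mdeg1 mul1n.
have b'_neq0 : b != 0 by apply: addXn_neq0.
have lead_b : (mlead b (inord 2) < 2 * W)%N.
  apply: leq_ltn_trans (mnm_le_mdeg _ _) _; apply: leq_ltn_trans (mdeg_mlead_le _) _.
  by apply: leq_ltn_trans (msizeD_Xn_le _ _ Wb0) _; rewrite mul2n -addnn ltn_add2r.
apply: comp_mpoly_inj => [i|e e' /mnmP E].
  rewrite tnth_mktuple (tnth_nth 0).
  by case: i => -[|[|[|[|//]]]] /= _; rewrite ?oppr_eq0 ?mulf_neq0.
have lead_muq : mlead (mu * q) = (U_(inord 3) + U_(inord 2) *+ (2 * W))%MM.
  by rewrite mleadM // lead_q mleadXm.
have lead_mub : mlead (- (mu * b)) = (U_(inord 3) + mlead b)%MM.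
  by rewrite mleadN mleadM // mleadXm.
have o1 : lift ord0 ord0 = 1 :> 'I_4 by apply/val_inj.
have o2 : lift ord0 (lift ord0 ord0) = 2 :> 'I_4 by apply/val_inj.
have o3 : lift ord0 (lift ord0 (lift ord0 ord0)) = 3 :> 'I_4 by apply/val_inj.
have {}E j : (mlead x0 j * e 0%R + (mlead x1 j * e 1%R
      + (mlead (mu * q) j * e 2%R + mlead (- (mu * b)) j * e 3%R))
    = mlead x0 j * e' 0%R + (mlead x1 j * e' 1%R
      + (mlead (mu * q) j * e' 2%R + mlead (- (mu * b)) j * e' 3%R)))%N.
  have := E j; rewrite !mnm_sumE !big_ord_recl !big_ord0 !mulmnE !tnth_mktuple.
  by rewrite !(tnth_nth 0) /= !addn0 o1 o2 o3.
have [x02 x03 x12 x13] := x_lead0.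
(* Variables 2 and 3 are absent from the leading monomials of [x0] and [x1], so they determine the
   last two exponents; [x_lead] then determines the first two. *)
have := E (inord 2); rewrite x02 x12 !mul0n !add0n lead_muq lead_mub => E2.
have := E (inord 3); rewrite x03 x13 !mul0n !add0n lead_muq lead_mub => E3.
have [e2 e3] : e 2%R = e' 2%R /\ e 3%R = e' 3%R.
  move: E2 E3; rewrite !mnmDE !mulmnE !mnm1E !eqxx -!val_eqE /= !inordK //=.
  rewrite !mul1n ?mul0n !add0n ?addn0.
  move=> E2' E3'; have det : (2 * W * (1 + mlead b (inord 3)) != 1 * mlead b (inord 2))%N.
    by apply/eqP => EW; move: lead_b; rewrite -[mlead b _]mul1n -EW ltnNge leq_pmulr.
  by apply: (linear_system2_inj det E2'); rewrite !mul1n.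
have {}E j : (mlead x0 j * e 0%R + mlead x1 j * e 1%R
    = mlead x0 j * e' 0%R + mlead x1 j * e' 1%R)%N.
  by have := E j; rewrite e2 e3 !addnA => /addIn /addIn.
have [e0 e1] := linear_system2_inj x_lead (E (inord 0)) (E (inord 1)).
apply/mnmP; case=> -[|[|[|[|//]]]] lt_i.
- by have -> : Ordinal lt_i = 0 by apply/val_inj.
- by have -> : Ordinal lt_i = 1 by apply/val_inj.
- by have -> : Ordinal lt_i = 2 by apply/val_inj.
- by have -> : Ordinal lt_i = 3 by apply/val_inj.
Qed.

End Parametrization.

(** * Bisections and sections over the quadric U *)

Section FirstPart.

Variables (k : fieldType) (v : 'rV[k]_22).
Hypotheses (k_char : 2%N \notin [pchar k]) (h_neq0 : ph v 2 != 0) (vU : in_U v).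
Hypothesis smooth : smooth_generic_fibre (C10 v).

Let s : {mpoly k[4]} := 'X_(inord 0).
Let t : {mpoly k[4]} := 'X_(inord 1).

Let s_neq0 : s != 0. Proof. by rewrite -msupp_eq0 msuppX. Qed.
Let t_neq0 : t != 0. Proof. by rewrite -msupp_eq0 msuppX. Qed.

Lemma specializeE n : (n < 22)%N -> specialize v 0 (inord n) =
  [:: pa v 0; pa v 1; pa v 2; pa v 3; pa v 4;
      pb v 0; pb v 1; pb v 2 + pc v 0; pb v 3 + pc v 1; pc v 2;
      0; 0; pc v 3;
      pd v 0; pd v 1; pd v 2 + pg v 0; pg v 1; ph v 0;
      0; pg v 2; ph v 1;
      ph v 2]`_n.
Proof. by move=> n22; rewrite mxE inordK. Qed.

Lemma s00_specialize (x0 x1 : {mpoly k[4]}) :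
  s00 (specialize v) (@mpolyC 4 k) x0 x1 = (pa v 2)%:MP * (x0 ^+ 2 * x1 ^+ 2).
Proof.
have [a0 a1 a3 a4 _] := vU.
by rewrite /s00 /form4 !specializeE //= a0 a1 a3 a4 !mpolyC0; ring.
Qed.

Lemma s02_specialize (x0 x1 : {mpoly k[4]}) :
  s02 (specialize v) (@mpolyC 4 k) x0 x1 = (pc v 3)%:MP * x1 ^+ 2.
Proof. by rewrite /s02 /form2 !specializeE //= !mpolyC0; ring. Qed.

Lemma s22_specialize : s22 (specialize v) (@mpolyC 4 k) = (ph v 2)%:MP.
Proof. by rewrite /s22 specializeE. Qed.

(* x_0 = s t, c_3 x_1 = s^2 + a_2 h_2 t^2 parametrizes the double cover from its
   point (x_0 : x_1 : z) = (0 : 1 : c_3); replacing s by s^2 makes the leading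
   monomials of x_0 and x_1 independent. *)
Lemma unirational_bisection : pc v 3 != 0 -> unirational [:: 2; 2; 0]%N (C10 v).
Proof.
move=> c3_neq0.
pose x1 := (pc v 3)^-1 *: (s ^+ 4 + (pa v 2 * ph v 2) *: t ^+ 2).
have lead_s4 : mlead (s ^+ 4) = (U_(inord 0) *+ 4)%MM by rewrite mleadX // mleadXm.
have lead_x1' : mlead (s ^+ 4 + (pa v 2 * ph v 2) *: t ^+ 2) = (U_(inord 0) *+ 4)%MM.
  rewrite mleadDl // lead_s4; apply: le_lt_trans (mleadZ_le _ _) _.
  by rewrite mleadX // mleadXm; apply: lt_mdeg_ltmc; rewrite !mdegMn !mdeg1.
have lead_x1 : mlead x1 = (U_(inord 0) *+ 4)%MM by rewrite mleadZ ?invr_eq0.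
have lead_x0 : mlead (s ^+ 2 * t) = (U_(inord 0) *+ 2 + U_(inord 1))%MM.
  by rewrite mleadM ?expf_neq0 // mleadX // !mleadXm.
have w21 : specialize v 0 (inord 21) != 0 by rewrite specializeE.
(* The quadratic equation for p has the roots -a_2 t^2 x_1 and -s^4 x_1 / h_2; the first is
   taken. *)
apply: (unirational_of_bisection k_char w21 smooth (x0 := s ^+ 2 * t) (x1 := x1)
  (p := - (pa v 2) *: (t ^+ 2 * x1))) => //.
- by rewrite mulf_neq0 ?expf_neq0.
- apply: contra_eq_neq lead_x1 => ->; rewrite mlead0; apply/eqP.
  by move=> /(congr1 mdeg); rewrite mdeg0 mdegMn mdeg1.
- rewrite lead_x0 lead_x1 !(mulmnE, mnmDE) !mnm1E -!val_eqE /= !inordK //.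
- rewrite lead_x0 lead_x1 !(mulmnE, mnmDE) !mnm1E -!val_eqE /= !inordK //.
rewrite s00_specialize s02_specialize s22_specialize.
have c3x1 : (pc v 3)%:MP * x1 = s ^+ 4 + (pa v 2 * ph v 2)%:MP * t ^+ 2.
  by rewrite mul_mpolyC scalerA divff // scale1r mul_mpolyC.
rewrite -mul_mpolyC mpolyCN.
transitivity ((pa v 2)%:MP * x1 ^+ 2 * (s ^+ 4 * t ^+ 2 - t ^+ 2 * ((pc v 3)%:MP * x1)
   + (ph v 2)%:MP * (pa v 2)%:MP * t ^+ 4)); first by ring.
by rewrite c3x1 mpolyCM; ring.
Qed.

(** With c_3 = 0 the equation for p is h_2 p^2 = -a_2 x_0^2 x_1^2, and r x_0 x_1 / h_2 solves it: a
    section over P^1 itself. *)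
Lemma unirational_section (r : k) : pc v 3 = 0 -> r ^+ 2 = - (pa v 2 * ph v 2) ->
  unirational [:: 2; 2; 0]%N (C10 v).
Proof.
move=> c3_0 r2.
have w21 : specialize v 0 (inord 21) != 0 by rewrite specializeE.
apply: (unirational_of_bisection k_char w21 smooth (x0 := s) (x1 := t)
  (p := (r / ph v 2) *: (s * t))) => //.
- by rewrite !mleadXm !mnm1E -!val_eqE /= !inordK.
- by rewrite !mleadXm !mnm1E -!val_eqE /= !inordK.
rewrite s00_specialize s02_specialize s22_specialize c3_0 mpolyC0 mul0r mul0r addr0.
rewrite -mul_mpolyC.
transitivity (((pa v 2)%:MP + (ph v 2)%:MP * (r / ph v 2)%:MP ^+ 2) * (s ^+ 2 * t ^+ 2)).
  by ring.
have -> : (ph v 2)%:MP * (r / ph v 2)%:MP ^+ 2 = (- pa v 2)%:MP :> {mpoly k[4]}.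
  rewrite expr2 -!mpolyCM; congr (_%:MP).
  transitivity (r ^+ 2 / ph v 2); first by field.
  by rewrite r2 mulNr mulfK.
by rewrite mpolyCN subrr mul0r.
Qed.

End FirstPart.

(** * The specialized locus *)

Definition U'_zeros : seq nat := [:: 0; 1; 3; 4; 10; 11; 18]%N.

(** Since b_2, c_0, b_3, c_1 enter only through b_2 + c_0 and b_3 + c_1, the quadric equation can
    always be met by a lift. Hence the locus is an open part of a linear space. *)
Lemma U'P (k : fieldType) (u : 'rV[k]_22) :
  U' u <-> (forall i, i \in U'_zeros -> u 0 (inord i) = 0) /\ u 0 (inord 21) != 0.
Proof.
split=> [[v [h_neq0 [a0 a1 a3 a4 _] ->]]|[u0 h_neq0]].
  split; last by rewrite mxE inordK.
  by move=> i; rewrite !inE; repeat case/orP; move/eqP->; rewrite mxE inordK //= ?a0 ?a1 ?a3 ?a4.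
pose U i := u 0 (inord i).
(* c_0 = 1 and b_3 = b_0 c_3 satisfy the quadric equation; b_2 and c_1 absorb the difference. *)
pose l :=
  [:: 0; 0; U 2%N; 0; 0; U 5%N; U 6%N; U 7%N - 1; U 5%N * U 12%N;
      1; U 8%N - U 5%N * U 12%N; U 9%N; U 12%N;
      U 13%N; U 14%N; U 15%N; 0; U 16%N; U 19%N; U 17%N; U 20%N; U 21%N].
pose v : 'rV[k]_22 := \row_(n < 22) l`_n.
have vE i : (i < 22)%N -> v 0 (inord i) = l`_i by move=> i22; rewrite mxE inordK.
have uE i : i \in U'_zeros -> U i = 0 by exact: u0.
exists v; split.
- by rewrite /ph vE.
- by rewrite /in_U /pa /pb /pc !vE //=; split=> //; rewrite mul1r subrr.
apply/rowP => n; rewrite mxE /pa /pb /pc /pd /pg /ph !vE //=.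
rewrite subrK [U 5%N * _ + _]addrC subrK addr0.
have -> : u 0 n = U n by rewrite /U inord_val.
by case: n; do 22![case=> [_ /=|]; first by [|rewrite uE]].
Qed.

Lemma mask_U' (k : fieldType) (x : 'I_22 -> k) (u : 'rV[k]_22)
    (uE : u = \row_n (if (n : nat) \in U'_zeros then 0 else x n)) :
  x (inord 21) != 0 -> U' u.
Proof.
move=> x_neq0; apply/U'P; rewrite uE; split=> [i iz|]; last by rewrite mxE inordK.
rewrite mxE inordK ?iz //; move: iz; rewrite !inE.
by repeat case/orP; move/eqP->.
Qed.

(** The locus is a linear space minus a hyperplane. The substitution [T] restricts polynomials to
    the linear space, where they form an integral domain. *)
Lemma U'_subvariety (k : fieldType) : infinite_type k -> is_subvariety (@U' k).
Proof.
move=> k_inf; split.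
- exists (\row_n (if (n : nat) \in U'_zeros then 0 else 1)).
  by apply: (mask_U' (x := fun _ => 1)); rewrite ?oner_neq0.
- exists (fun f => exists2 i, i \in U'_zeros & f = 'X_(inord i)), (fun f => f = 'X_(inord 21)).
  split=> [f [[i _ ->]|->]|u].
  + by exists 1%N; rewrite dhomogX; apply/eqP; exact: mdeg1.
  + by exists 1%N; rewrite dhomogX; apply/eqP; exact: mdeg1.
  split=> [/U'P[u0 h_neq0]|[_ u0 [f -> h_neq0]]].
    split; last by exists 'X_(inord 21) => //; rewrite /vanishes mevalXU; apply/eqP.
      by apply: contraNneq h_neq0 => ->; rewrite mxE.
    by move=> f [i iz ->]; rewrite /vanishes mevalXU u0.
  apply/U'P; split=> [i iz|]; last by apply/eqP => h0; apply: h_neq0; rewrite /vanishes mevalXU.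
  by have := u0 'X_(inord i) (ex_intro2 _ _ i iz erefl); rewrite /vanishes mevalXU.
move=> f g _ _ fg0.
pose T := [tuple (if (n : nat) \in U'_zeros then 0 else 'X_n) : {mpoly k[22]} | n < 22].
have evalT e (x : 'I_22 -> k) : (e \mPo T).@[x]
   = e.@[fun n => (\row_n (if (n : nat) \in U'_zeros then 0 else x n)) 0 n].
  rewrite comp_mpoly_meval; apply: meval_eq => n; rewrite tnth_mktuple mxE.
  by case: ifP => _; rewrite ?meval0 ?mevalXU.
have vanishT e : e \mPo T = 0 -> forall u, U' u -> vanishes e u.
  move=> e0 u /U'P[u0 _]; have := evalT e (fun n => u 0 n); rewrite e0 meval0 => /esym.
  rewrite /vanishes => eu; rewrite -[RHS]eu; apply: meval_eq => n; rewrite mxE.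
  by case: ifP => // nz; have := u0 _ nz; rewrite inord_val.
(* The last factor makes the product vanish also where h_2 = 0, hence at every point. *)
have : (f \mPo T) * (g \mPo T) * 'X_(inord 21) = 0.
  apply: (mpoly_eq0_inf k_inf) => x; rewrite !mevalM mevalXU.
  have [->|x_neq0] := eqVneq (x (inord 21)) 0; first by rewrite mulr0.
  have := fg0 _ (mask_U' (x := x) erefl x_neq0); rewrite /vanishes mevalM -!evalT => ->.
  by rewrite mul0r.
have X_neq0 : 'X_(inord 21) != 0 :> {mpoly k[22]} by rewrite -msupp_eq0 msuppX.
move/eqP; rewrite !mulf_eq0 (negPf X_neq0) orbF => /orP[]/eqP e0.
  by left; apply: vanishT.
by right; apply: vanishT.
Qed.

(** * Automorphisms of T_{2,2,0} *)

Lemma rmorph_form2 (S S' : comNzRingType) (g : {rmorphism S -> S'}) (c : nat -> S)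
    (x y : S) : g (form2 c x y) = form2 (g \o c) (g x) (g y).
Proof. by rewrite /form2 !(rmorphD, rmorphM, rmorphXn). Qed.

(* The binary quadratic form [form2 r], resp. quartic form [form4 r], after the
   substitution x -> a x + b y, y -> c x + d y. *)
Definition subst2 (S : comNzRingType) (r : nat -> S) (a b c d : S) : nat -> S :=
  nth 0 [:: r 0 * a ^+ 2 + r 1 * (a * c) + r 2 * c ^+ 2;
            2 * r 0 * (a * b) + r 1 * (a * d + b * c) + 2 * r 2 * (c * d);
            r 0 * b ^+ 2 + r 1 * (b * d) + r 2 * d ^+ 2].

Lemma form2_subst2 (S S' : comNzRingType) (g : {rmorphism S -> S'}) (r : nat -> S)
    (a b c d : S) (x y : S') :
  form2 (g \o subst2 r a b c d) x y
    = form2 (g \o r) (g a * x + g b * y) (g c * x + g d * y).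
Proof.
rewrite /form2 /subst2 /=.
by ring.
Qed.

Definition subst4 (S : comNzRingType) (r : nat -> S) (a b c d : S) : nat -> S :=
  nth 0 [:: r 0 * a ^+ 4 + r 1 * (a ^+ 3 * c) + r 2 * (a ^+ 2 * c ^+ 2)
              + r 3 * (a * c ^+ 3) + r 4 * c ^+ 4;
            r 0 * (4 * a ^+ 3 * b) + r 1 * (a ^+ 3 * d + 3 * a ^+ 2 * b * c)
              + r 2 * (2 * a ^+ 2 * c * d + 2 * a * b * c ^+ 2)
              + r 3 * (b * c ^+ 3 + 3 * a * c ^+ 2 * d) + r 4 * (4 * c ^+ 3 * d);
            r 0 * (6 * a ^+ 2 * b ^+ 2) + r 1 * (3 * a ^+ 2 * b * d + 3 * a * b ^+ 2 * c)
              + r 2 * (a ^+ 2 * d ^+ 2 + 4 * a * b * c * d + b ^+ 2 * c ^+ 2)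
              + r 3 * (3 * b * c ^+ 2 * d + 3 * a * c * d ^+ 2)
              + r 4 * (6 * c ^+ 2 * d ^+ 2);
            r 0 * (4 * a * b ^+ 3) + r 1 * (b ^+ 3 * c + 3 * a * b ^+ 2 * d)
              + r 2 * (2 * b ^+ 2 * c * d + 2 * a * b * d ^+ 2)
              + r 3 * (a * d ^+ 3 + 3 * b * c * d ^+ 2) + r 4 * (4 * c * d ^+ 3);
            r 0 * b ^+ 4 + r 1 * (b ^+ 3 * d) + r 2 * (b ^+ 2 * d ^+ 2)
              + r 3 * (b * d ^+ 3) + r 4 * d ^+ 4].

Lemma form4_subst4 (S S' : comNzRingType) (g : {rmorphism S -> S'}) (r : nat -> S)
    (a b c d : S) (x y : S') :
  form4 (g \o subst4 r a b c d) x y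
    = form4 (g \o r) (g a * x + g b * y) (g c * x + g d * y).
Proof.
rewrite /form4 /subst4 /=.
by ring.
Qed.

Lemma stableE (L : fieldType) (p : 'I_5 -> L) :
  stable p = ((p (inord 0) != 0) || (p (inord 1) != 0))
    && [|| p (inord 2) != 0, p (inord 3) != 0 | p (inord 4) != 0].
Proof.
rewrite /stable; congr (_ && _); apply/existsP/idP.
- case=> i /andP[i2]; rewrite -[i in p i]inord_val.
  by case: i i2 => -[|[|//]] /= _ _ ->; rewrite ?orbT.
- by case/orP=> p_neq0; [exists (inord 0) | exists (inord 1)]; rewrite inordK.
- case=> i /andP[i2]; rewrite -[i in p i]inord_val.
  by case: i i2 => -[|[|[|[|[|//]]]]] //= _ _ ->; rewrite ?orbT.
by case/or3P=> p_neq0; [exists (inord 2) | exists (inord 3) | exists (inord 4)];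
  rewrite inordK.
Qed.

Section Frame.

Variables (k : fieldType) (a b c d m : k) (r s : nat -> k).

Let X i : {mpoly k[5]} := 'X_(inord i).
Let C := @mpolyC 5 k.

(** These automorphisms suffice for density: the x-part moves the double root, [m] shears y_1 by
    y_0, and [r], [s] adjust the completed square. *)
Definition frame_map : 5.-tuple {mpoly k[5]} :=
  [tuple C a * X 0 + C b * X 1; C c * X 0 + C d * X 1; X 2; X 3 + C m * X 2;
         X 4 + form2 (C \o r) (X 0) (X 1) * X 2 + form2 (C \o s) (X 0) (X 1) * X 3].

Lemma mmap_frame_map (S : comNzRingType) (iota : {rmorphism k -> S}) (p : 'I_5 -> S)
    (x0 := p (inord 0)) (x1 := p (inord 1)) (i : nat) : (i < 5)%N ->
  mmap iota p (tnth frame_map (inord i)) =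
    nth 0 [:: iota a * x0 + iota b * x1; iota c * x0 + iota d * x1; p (inord 2);
              p (inord 3) + iota m * p (inord 2);
              p (inord 4) + form2 (iota \o r) x0 x1 * p (inord 2)
                + form2 (iota \o s) x0 x1 * p (inord 3)] i.
Proof.
move=> i5; rewrite (tnth_nth 0) inordK //.
pose g : {rmorphism {mpoly k[5]} -> S} := mmap iota p.
have gX j : g (X j) = p (inord j) by rewrite /g /= mmapX mmap1U.
have gC e : g (C e) = iota e by rewrite /g /= mmapC.
have gF e : g (form2 (C \o e) (X 0) (X 1)) = form2 (iota \o e) x0 x1.
  by rewrite rmorph_form2 !gX /form2 /= !mmapC.
rewrite -/g; case: i i5 => [|[|[|[|[|//]]]]] _ /=.
- by rewrite (rmorphD g) !(rmorphM g) !gX !gC.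
- by rewrite (rmorphD g) !(rmorphM g) !gX !gC.
- exact: gX.
- by rewrite (rmorphD g) !(rmorphM g) !gX !gC.
- by rewrite !(rmorphD g) !(rmorphM g) !gF !gX.
Qed.

Lemma bideg_mnmD w (m1 m2 : 'X_{1..5}) : bideg w (m1 + m2)%MM = bideg w m1 + bideg w m2.
Proof. by rewrite -big_split; apply: eq_bigr => i _; rewrite mnmDE mulrnDr. Qed.

Lemma bihomogD w e (F G : {mpoly k[5]}) :
  bihomog w e F -> bihomog w e G -> bihomog w e (F + G).
Proof. by move=> hF hG n /msuppD_le; rewrite mem_cat => /orP[/hF|/hG]. Qed.

Lemma bihomogM w e e' (F G : {mpoly k[5]}) :
  bihomog w e F -> bihomog w e' G -> bihomog w (e + e') (F * G).
Proof.
move=> hF hG n /msuppM_le /allpairsP [[n1 n2] /= [h1 h2 ->]].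
by rewrite bideg_mnmD (hF _ h1) (hG _ h2).
Qed.

Lemma bihomogC w e : bihomog w 0 (C e).
Proof.
move=> n; rewrite /C msuppC; case: eqP => // _; rewrite inE => /eqP ->.
by rewrite /bideg big1 // => i _; rewrite mnm0E mulr0n.
Qed.

Lemma bihomogX w i : (i < 5)%N -> bihomog w (vdeg w i) (X i).
Proof.
move=> i5 n; rewrite msuppX inE => /eqP ->; rewrite /bideg (bigD1 (inord i)) //=.
rewrite big1 => [|j ji]; first by rewrite mnm1E eqxx mulr1n addr0 inordK.
by rewrite mnm1E eq_sym (negPf ji) mulr0n.
Qed.

Lemma bihomogX2 w e (F : {mpoly k[5]}) : bihomog w e F -> bihomog w (e + e) (F ^+ 2).
Proof. by move=> hF; rewrite expr2; apply: bihomogM. Qed.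

Lemma bihomog_form2 w (e : nat -> k) : bihomog w (2, 0) (form2 (C \o e) (X 0) (X 1)).
Proof.
have h0 : bihomog w (1, 0) (X 0) by exact: bihomogX.
have h1 : bihomog w (1, 0) (X 1) by exact: bihomogX.
have -> : (2, 0) = 0 + ((1, 0) + (1, 0)) :> (int * int)%type by [].
rewrite /form2 /=; apply: bihomogD; [apply: bihomogD|].
- exact: (bihomogM (@bihomogC _ _) (bihomogX2 h0)).
- exact: (bihomogM (@bihomogC _ _) (bihomogM h0 h1)).
- exact: (bihomogM (@bihomogC _ _) (bihomogX2 h1)).
Qed.

Hypothesis det1 : a * d - b * c = 1.

Lemma frame_map_endo : toric_endo [:: 2; 2; 0]%N frame_map.
Proof.
split.
  exists (1, 0), (0, 1) => i.
  have -> : tnth frame_map i = nth 0 frame_map i by rewrite (tnth_nth 0).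
  have Z (e : k) (e' : int * int) j : (j < 5)%N -> vdeg [:: 2; 2; 0]%N j = e' ->
    bihomog [:: 2; 2; 0]%N e' (C e * X j).
    by move=> j5 <-; rewrite -[vdeg _ _]add0r; apply: bihomogM (@bihomogC _ _) (@bihomogX _ _ j5).
  have V j e' : (j < 5)%N -> vdeg [:: 2; 2; 0]%N j = e' -> bihomog [:: 2; 2; 0]%N e' (X j).
    by move=> j5 <-; apply: bihomogX.
  have Q e j : (j = 2 \/ j = 3)%N ->
    bihomog [:: 2; 2; 0]%N (0, 1) (form2 (C \o e) (X 0) (X 1) * X j).
    move=> jE; have -> : (0, 1) = (2, 0) + (- 2, 1) :> (int * int)%type by [].
    by apply: (bihomogM (@bihomog_form2 _ e)); apply: V; case: jE => ->.
  case: i => -[|[|[|[|[|//]]]]] lt_i /=.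
  - have -> : (1, 0) *~ 1 + (0, 1) *~ 0 = (1, 0) :> (int * int)%type by [].
    by apply: bihomogD; apply: Z.
  - have -> : (1, 0) *~ 1 + (0, 1) *~ 0 = (1, 0) :> (int * int)%type by [].
    by apply: bihomogD; apply: Z.
  - exact: V.
  - by apply: bihomogD; [apply: V | apply: Z].
  apply: bihomogD; [apply: bihomogD|].
  - exact: V.
  - by apply: Q; left.
  - by apply: Q; right.
(* No base points: the x-part is invertible and the y-part unitriangular. *)
move=> L iota p; rewrite !stableE /eval_at !mmap_frame_map //=.
move: (p (inord 0)) (p (inord 1)) (p (inord 2)) (p (inord 3)) (p (inord 4)).
move=> x0 x1 y0 y1 y2 /andP[x_neq0 y_neq0]; apply/andP; split.
  apply: contraTT x_neq0; rewrite !negb_or !negbK => /andP[/eqP e0 /eqP e1].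
  have det1' : iota a * iota d - iota b * iota c = 1 by rewrite -!rmorphM -rmorphB det1 rmorph1.
  have x00 : x0 = 0.
    rewrite -[x0]mul1r -det1'.
    transitivity (iota d * (iota a * x0 + iota b * x1) - iota b * (iota c * x0 + iota d * x1)).
      by ring.
    by rewrite e0 e1 !mulr0 subrr.
  have x10 : x1 = 0.
    rewrite -[x1]mul1r -det1'.
    transitivity (iota a * (iota c * x0 + iota d * x1) - iota c * (iota a * x0 + iota b * x1)).
      by ring.
    by rewrite e0 e1 !mulr0 subrr.
  by rewrite x00 x10 eqxx.
apply: contraTT y_neq0; rewrite !negb_or !negbK => /and3P[/eqP ->].
by rewrite !mulr0 !addr0 => /eqP ->; rewrite mulr0 addr0 => ->; rewrite eqxx.
Qed.

End Frame.

(** Inverting the unitriangular y-part forces r' = -r + m s and s' = -s, read in the new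
    x-coordinates. *)
Lemma frame_map_inverse (k : fieldType) (a b c d m : k) (r s r' s' : nat -> k) :
  a * d - b * c = 1 ->
  (forall (L : fieldType) (iota : {rmorphism k -> L}) (x y : L),
     form2 (iota \o r') (iota a * x + iota b * y) (iota c * x + iota d * y)
       = - form2 (iota \o r) x y + iota m * form2 (iota \o s) x y) ->
  (forall (L : fieldType) (iota : {rmorphism k -> L}) (x y : L),
     form2 (iota \o s') (iota a * x + iota b * y) (iota c * x + iota d * y)
       = - form2 (iota \o s) x y) ->
  inverse_endo [:: 2; 2; 0]%N (frame_map a b c d m r s)
    (frame_map d (- b) (- c) a (- m) r' s').
Proof.
move=> det1 rE sE L iota p _; exists 1, 1; split; rewrite ?oner_neq0 // => i.
rewrite !exp1rz !mul1r -[in LHS](inord_val i) -[in RHS](inord_val i) /eval_at.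
rewrite mmap_frame_map // !mmap_frame_map //= rE sE.
have det1' : iota a * iota d - iota b * iota c = 1 by rewrite -!rmorphM -rmorphB det1 rmorph1.
case: i => -[|[|[|[|[|//]]]]] lt_i /=; rewrite ?rmorphN.
- transitivity ((iota a * iota d - iota b * iota c) * p (inord 0)); first by ring.
  by rewrite det1' mul1r.
- transitivity ((iota a * iota d - iota b * iota c) * p (inord 1)); first by ring.
  by rewrite det1' mul1r.
- by [].
- by ring.
- by ring.
Qed.

Lemma frame_map_aut (k : fieldType) (a b c d m : k) (r s : nat -> k) :
  a * d - b * c = 1 -> toric_aut [:: 2; 2; 0]%N (frame_map a b c d m r s).
Proof.
move=> det1.
pose r' i := m * subst2 s d (- b) (- c) a i - subst2 r d (- b) (- c) a i.
pose s' i := - subst2 s d (- b) (- c) a i.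
have form2B (L : fieldType) (iota : {rmorphism k -> L}) (e f : nat -> k) x y :
    form2 (iota \o (fun i => m * e i - f i)) x y
    = iota m * form2 (iota \o e) x y - form2 (iota \o f) x y.
  by rewrite /form2 /= ; ring.
have form2N (L : fieldType) (iota : {rmorphism k -> L}) (e : nat -> k) x y :
    form2 (iota \o (fun i => - e i)) x y = - form2 (iota \o e) x y.
  by rewrite /form2 /= ; ring.
have det' : d * a - - b * - c = 1 by rewrite -det1; ring.
have back (L : fieldType) (iota : {rmorphism k -> L}) (x y : L) :
     (iota d * (iota a * x + iota b * y) + iota (- b) * (iota c * x + iota d * y) = x)
  /\ (iota (- c) * (iota a * x + iota b * y) + iota a * (iota c * x + iota d * y) = y).
  have det1' : iota a * iota d - iota b * iota c = 1 by rewrite -!rmorphM -rmorphB det1 rmorph1.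
  split; [rewrite -[RHS]mul1r -det1' | rewrite -[RHS]mul1r -det1']; ring.
have rE (L : fieldType) (iota : {rmorphism k -> L}) (x y : L) :
     form2 (iota \o r') (iota a * x + iota b * y) (iota c * x + iota d * y)
       = - form2 (iota \o r) x y + iota m * form2 (iota \o s) x y.
  rewrite form2B !form2_subst2; have [-> ->] := back _ iota x y.
  by rewrite addrC.
have sE (L : fieldType) (iota : {rmorphism k -> L}) (x y : L) :
     form2 (iota \o s') (iota a * x + iota b * y) (iota c * x + iota d * y)
       = - form2 (iota \o s) x y.
  by rewrite form2N !form2_subst2; have [-> ->] := back _ iota x y.
split; first exact: frame_map_endo.
exists (frame_map d (- b) (- c) a (- m) r' s'); split.
- exact: frame_map_endo.
- exact: frame_map_inverse.
have := @frame_map_inverse k d (- b) (- c) a (- m) r' s' r s det'.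
rewrite !opprK; apply=> L iota x y.
- by rewrite form2B form2N !form2_subst2; ring.
- by rewrite form2N form2_subst2 opprK.
Qed.

(** * Density of the orbit *)

Lemma eq_conicQ (S : comNzRingType) (u u' : nat -> S) (x0 x1 y0 y1 y2 : S) :
  (forall n, (n < 22)%N -> u n = u' n) ->
  conicQ u x0 x1 y0 y1 y2 = conicQ u' x0 x1 y0 y1 y2.
Proof. by move=> uu'; rewrite /conicQ /form4 /form2 !uu'. Qed.

(* The coefficients of
   h (y_2 + r_0 y_0 + r_1 y_1)^2 + q_00 y_0^2 + q_01 y_0 y_1 + q_11 y_1^2. *)
Definition square_conic (S : comNzRingType) (h : S) (r0 r1 q00 q01 q11 : nat -> S) :
    nat -> S :=
  nth 0 [:: q00 0 + h * r0 0 ^+ 2;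
            q00 1 + 2 * h * (r0 0 * r0 1);
            q00 2 + h * (r0 1 ^+ 2 + 2 * r0 0 * r0 2);
            q00 3 + 2 * h * (r0 1 * r0 2);
            q00 4 + h * r0 2 ^+ 2;
            q01 0 + 2 * h * (r0 0 * r1 0);
            q01 1 + 2 * h * (r0 0 * r1 1 + r0 1 * r1 0);
            q01 2 + 2 * h * (r0 0 * r1 2 + r0 1 * r1 1 + r0 2 * r1 0);
            q01 3 + 2 * h * (r0 1 * r1 2 + r0 2 * r1 1);
            q01 4 + 2 * h * (r0 2 * r1 2);
            2 * h * r0 0; 2 * h * r0 1; 2 * h * r0 2;
            q11 0 + h * r1 0 ^+ 2;
            q11 1 + 2 * h * (r1 0 * r1 1);
            q11 2 + h * (r1 1 ^+ 2 + 2 * r1 0 * r1 2);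
            q11 3 + 2 * h * (r1 1 * r1 2);
            q11 4 + h * r1 2 ^+ 2;
            2 * h * r1 0; 2 * h * r1 1; 2 * h * r1 2;
            h].

Lemma conicQ_square (S S' : comNzRingType) (g : {rmorphism S -> S'}) (h : S)
    (r0 r1 q00 q01 q11 : nat -> S) (x0 x1 y0 y1 y2 : S') :
  conicQ (g \o square_conic h r0 r1 q00 q01 q11) x0 x1 y0 y1 y2 =
    g h * (y2 + form2 (g \o r0) x0 x1 * y0 + form2 (g \o r1) x0 x1 * y1) ^+ 2
    + form4 (g \o q00) x0 x1 * y0 ^+ 2 + form4 (g \o q01) x0 x1 * (y0 * y1)
    + form4 (g \o q11) x0 x1 * y1 ^+ 2.
Proof. by rewrite /conicQ /square_conic /form2 /form4 /=; ring. Qed.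

(* The coefficients of A l^4 + B l^3 x_0 + E l^2 x_0^2 for l = x_1 - N x_0. *)
Definition double_root (S : comNzRingType) (A B E N : S) : nat -> S :=
  nth 0 [:: N ^+ 4 * A - N ^+ 3 * B + N ^+ 2 * E;
            - 4 * N ^+ 3 * A + 3 * N ^+ 2 * B - 2 * N * E;
            6 * N ^+ 2 * A - 3 * N * B + E;
            - 4 * N * A + B;
            A].

Section OrbitElement.

Variables (k : fieldType) (h c a t N m : k) (r0 r1 q01 q11 : nat -> k).

(** For L = x_1 - N x_0 and M = x_0 + t L, this rewrites a quartic in terms of M and L, using x_0 =
    M - t L and x_1 = N M + (1 - N t) L. *)
Let inv4 q := subst4 q 1 (- t) N (1 - N * t).
Let b := inv4 (fun i => q01 i - 2 * m * q11 i).
Let d := inv4 q11.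

(** The source has s_00 = a M^2 L^2 and s_02 = 2 h c L^2; completing the square leaves a M^2 L^2 - h
    c^2 L^4, which is the [double_root] form here. The shear by [m] contributes the other terms. *)
Definition orbit_q00 i :=
  double_root (a * t ^+ 2 - h * c ^+ 2) (2 * a * t) a N i + m * q01 i - m ^+ 2 * q11 i.

Definition orbit_source : nat -> k :=
  nth 0 [:: 0; 0; a; 0; 0; b 0; b 1; b 2; b 3; b 4; 0; 0; 2 * h * c;
            d 0; d 1; d 2; d 3; d 4; 0; 0; 0; h].

(** The list holds the coefficients of L^2; subtracting compensates for the term c L^2 y_0 of the
    source. *)
Let s0 i := r0 i - c * nth 0 [:: N ^+ 2; - 2 * N; 1] i.

Lemma orbit_source_frame (S : comNzRingType) (g : {rmorphism k -> S})
    (x0 x1 y0 y1 y2 : S) :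
  conicQ (g \o orbit_source) (g (1 - t * N) * x0 + g t * x1) (g (- N) * x0 + g 1 * x1)
    y0 (y1 + g m * y0)
    (y2 + form2 (g \o s0) x0 x1 * y0 + form2 (g \o r1) x0 x1 * y1)
  = conicQ (g \o square_conic h r0 r1 orbit_q00 q01 q11) x0 x1 y0 y1 y2.
Proof.
rewrite conicQ_square /conicQ.
set M := _ + g t * x1; set L := _ + g 1 * x1.
have inv4E q : form4 (g \o inv4 q) M L = form4 (g \o q) x0 x1.
  by rewrite form4_subst4; congr form4; rewrite /M /L; ring.
have -> : form4 (fun i => (g \o orbit_source) (5 + i)%N) M L =
    form4 (g \o (fun i => q01 i - 2 * m * q11 i)) x0 x1 by rewrite -inv4E.
have -> : form4 (fun i => (g \o orbit_source) (13 + i)%N) M L = form4 (g \o q11) x0 x1.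
  by rewrite -inv4E.
rewrite /M /L /form4 /form2 /orbit_source /orbit_q00 /double_root /s0 /=.
by ring.
Qed.

End OrbitElement.

Lemma square_conic_in_orbit (k : fieldType) (h c a t N m : k) (r0 r1 q01 q11 : nat -> k) :
  h != 0 -> orbit_of [:: 2; 2; 0]%N (@U' k)
    (\row_n square_conic h r0 r1 (orbit_q00 h c a t N m q01 q11) q01 q11 n).
Proof.
move=> h_neq0.
pose s0 i := r0 i - c * nth 0 [:: N ^+ 2; - 2 * N; 1] i.
pose u : 'rV[k]_22 := \row_n orbit_source h c a t N m q01 q11 n.
exists (frame_map (1 - t * N) t (- N) 1 m s0 r1), u; split.
- by apply: frame_map_aut; ring.
- apply/U'P; split=> [i|]; last by rewrite mxE inordK.
  by rewrite !inE; repeat case/orP; move/eqP->; rewrite mxE inordK.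
rewrite conicE.
have E (C : k -> {mpoly k[5]}) (l : nat -> k) y :
    (forall n, (n < 22)%N -> C ((\row_(n < 22) l n) y (inord n)) = (C \o l) n).
  by move=> n n22; rewrite mxE inordK.
rewrite (eq_conicQ _ _ _ _ _ (@E (@mpolyC 5 k) _ 0)) -orbit_source_frame -/s0.
rewrite /comp_mpoly mmap_conic (eq_conicQ _ _ _ _ _ (@E (@mpolyC 5 k) _ 0)).
by rewrite !(tnth_nth 0) !inordK.
Qed.

Lemma square_conicE (S : comNzRingType) (h : S) (r0 r1 q00 q01 q11 : nat -> S) n :
  (n < 22)%N -> square_conic h r0 r1 q00 q01 q11 n =
  square_conic h r0 r1 (fun=> 0) (fun=> 0) (fun=> 0) n
  + [:: q00 0; q00 1; q00 2; q00 3; q00 4; q01 0; q01 1; q01 2; q01 3; q01 4;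
        0; 0; 0; q11 0; q11 1; q11 2; q11 3; q11 4; 0; 0; 0; 0]`_n.
Proof.
by move: n; do 22![case=> [_ /=|]; first by rewrite /square_conic /=; ring].
Qed.

(** * The Zariski closure of the orbit *)

Section Density.

Variables (k : fieldType) (f : {mpoly k[22]}).
Hypotheses (k_inf : infinite_type k) (k_char : 2 != 0 :> k).
Hypothesis f_orbit : forall v, orbit_of [:: 2; 2; 0]%N (@U' k) v -> vanishes f v.

Let value (z : nat -> k) := f.@[fun n => z n].

Let q00 A B E N m (q01 q11 : nat -> k) i :=
  double_root A B E N i + m * q01 i - m ^+ 2 * q11 i.

Lemma value_orbit (h c a t N m : k) (r0 r1 q01 q11 : nat -> k) : h != 0 ->
  value (square_conic h r0 r1 (q00 (a * t ^+ 2 - h * c ^+ 2) (2 * a * t) a N m q01 q11)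
    q01 q11) = 0.
Proof.
move=> h_neq0; rewrite -[RHS](f_orbit (square_conic_in_orbit c a t N m r0 r1 q01 q11 h_neq0)).
by apply: meval_eq => n; rewrite mxE.
Qed.

Let direction (w : nat -> k) (n : nat) : k := if (n < 5)%N then w n else 0.

(** Only the first five coordinates depend on A, and affinely, so varying A moves along a line. *)
Lemma value_A_line (h A B E N m : k) (r0 r1 q01 q11 : nat -> k) :
  value (square_conic h r0 r1 (q00 A B E N m q01 q11) q01 q11) =
  f.@[fun n => square_conic h r0 r1 (q00 0 B E N m q01 q11) q01 q11 n
        + A * direction (double_root 1 0 0 N) n].
Proof.
apply: meval_eq; case; rewrite /direction /square_conic /q00 /double_root.
by do 22?[case=> [_ /=|]; first by ring].
Qed.

Lemma value_E_line (h A B E N m : k) (r0 r1 q01 q11 : nat -> k) :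
  value (square_conic h r0 r1 (q00 A B E N m q01 q11) q01 q11) =
  f.@[fun n => square_conic h r0 r1 (q00 A B 0 N m q01 q11) q01 q11 n
        + E * direction (double_root 0 0 1 N) n].
Proof.
apply: meval_eq; case; rewrite /direction /square_conic /q00 /double_root.
by do 22?[case=> [_ /=|]; first by ring].
Qed.

(* [a t^2 - h c^2] takes infinitely many values, so the leading coefficient of the
   double root form is free in the Zariski closure. *)
Lemma value_double_root (h A B E N m : k) (r0 r1 q01 q11 : nat -> k) : h != 0 ->
  value (square_conic h r0 r1 (q00 A B E N m q01 q11) q01 q11) = 0.
Proof.
move=> h_neq0; rewrite value_E_line.
(* It is enough to treat E nonzero, where t = B / (2 E) makes sense. *)
apply: (@meval_line_eq0 _ _ _ _ _ (fun E => E != 0)) => [|{}E E_neq0].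
  exact: infinite_neq0.
rewrite -value_E_line value_A_line.
have [p pE] := meval_line f (fun n => square_conic h r0 r1 (q00 0 B E N m q01 q11) q01 q11 n)
  (fun n => direction (double_root 1 0 0 N) n).
(* With a = E and 2 a t = B, the values of [l] are leading coefficients reached in the orbit; as [l]
   is nonconstant, vanishing of [p \Po l] forces p = 0. *)
pose t := B / (2 * E); pose l : {poly k} := (E * t ^+ 2)%:P - h *: 'X^2.
have size_l : (1 < size l)%N.
  have : (size (- (h *: 'X^2) : {poly k}) = 3)%N.
    by rewrite size_polyN size_scale // size_polyXn.
  move=> s3; rewrite /l addrC size_polyDl s3 //.
  exact: leq_ltn_trans (size_polyC_leq1 _) _.
have : p \Po l = 0.
  apply: (poly_eq0_inf (infinite_true k_inf)) => c _.
  have lE : l.[c] = E * t ^+ 2 - h * c ^+ 2 by rewrite /l !hornerE.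
  have tE : B = 2 * E * t by rewrite /t; field; rewrite E_neq0.
  rewrite horner_comp -pE -value_A_line lE [in q00 _ B]tE.
  by apply: value_orbit.
by move=> /eqP; rewrite comp_poly_eq0 // => /eqP p0; rewrite pE p0 horner0.
Qed.

Section Coordinates.

Variable z : nat -> k.
Hypothesis h_neq0 : z 21 != 0.

Let h := z 21.
(** Completing the square at [z]: [base] is the contribution of the square, and [p], [b], [g] are
    the quartics left at y_0^2, y_0 y_1, y_1^2. *)
Let r0 i := z (10 + i)%N / (2 * h).
Let r1 i := z (18 + i)%N / (2 * h).
Let base := square_conic h r0 r1 (fun=> 0) (fun=> 0) (fun=> 0).
Let p i := z i - base i.
Let b i := z (5 + i)%N - base (5 + i)%N.
Let g i := z (13 + i)%N - base (13 + i)%N.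

(* A quartic form vanishes doubly at x_1 = N x_0 iff its coefficients of x_0^4
   and x_0^3 x_1 are [low0] and [low1] of the other three. *)
Let low0 (S : comNzRingType) (N D2 D3 D4 : S) :=
  3 * N ^+ 4 * D4 + 2 * N ^+ 3 * D3 + N ^+ 2 * D2.
Let low1 (S : comNzRingType) (N D2 D3 D4 : S) :=
  - 4 * N ^+ 3 * D4 - 3 * N ^+ 2 * D3 - 2 * N * D2.

(** Coordinates 0 and 1 forced by the double root N of q_00 - m q_01 + m^2 q_11, with the middle
    coefficient of q_11 set to 0. Through [j] they are scalars or polynomials. *)
Let rest0 (S : comNzRingType) (j : k -> S) (N m : S) :=
  j (base 0) + m * j (b 0) - m ^+ 2 * j (g 0)
  + low0 N (j (p 2) - m * j (b 2)) (j (p 3) - m * j (b 3) + m ^+ 2 * j (g 3))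
      (j (p 4) - m * j (b 4) + m ^+ 2 * j (g 4)).
Let rest1 (S : comNzRingType) (j : k -> S) (N m : S) :=
  j (base 1) + m * j (b 1) - m ^+ 2 * j (g 1)
  + low1 N (j (p 2) - m * j (b 2)) (j (p 3) - m * j (b 3) + m ^+ 2 * j (g 3))
      (j (p 4) - m * j (b 4) + m ^+ 2 * j (g 4)).

Lemma value_double_point (N m y : k) :
  value (fun n => match n with
    | 0 => rest0 id N m + N ^+ 2 * m ^+ 2 * y
    | 1 => rest1 id N m - 2 * (N * m ^+ 2 * y)
    | 15 => y + base 15
    | n => z n end) = 0.
Proof.
pose g' i := if i == 2 then y else g i.
pose D i := p i - m * b i + m ^+ 2 * g' i.
(* A, B and E come from expanding the quartic with upper coefficients D 2, D 3, D 4 in powers of x_1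
   - N x_0. *)
rewrite -[RHS](value_double_root (D 4) (D 3 + 4 * N * D 4)
  (D 2 + 3 * N * D 3 + 6 * N ^+ 2 * D 4) N m r0 r1 b g' h_neq0).
apply: meval_eq => n; rewrite square_conicE // -/base.
have base10 : [/\ base 10 = z 10, base 11 = z 11, base 12 = z 12,
    base 18 = z 18 & base 19 = z 19] /\ base 20 = z 20.
  have hK x : 2 * h * (x / (2 * h)) = x by field; rewrite h_neq0.
  by rewrite /base /square_conic /= /r0 /r1 !hK.
have [[e10 e11 e12 e18 e19] e20] := base10.
move: n; rewrite /rest0 /rest1 /low0 /low1 /D /g' /p /b /g /q00 /double_root.
move: base e10 e11 e12 e18 e19 e20 (erefl (base 21) : base 21 = h).
move=> base' e10 e11 e12 e18 e19 e20 e21.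
case; do 22![case=> [lt_n /=|]; first
  by [|rewrite addr0|ring]].
by [].
Qed.

Lemma rmorph_rest (S S' : comNzRingType) (e : {rmorphism S -> S'}) (j : k -> S)
    (j' : k -> S') (N m : S) : (forall c, e (j c) = j' c) ->
  e (rest0 j N m) = rest0 j' (e N) (e m) /\ e (rest1 j N m) = rest1 j' (e N) (e m).
Proof. by move=> ej; rewrite /rest0 /rest1 /low0 /low1 -!ej; split; ring. Qed.

(* The coordinate 15 is taken to be a high power of the third variable, which
   makes the leading monomials of the three moving coordinates independent in
   every characteristic other than 2. *)
Lemma value_eq0 : value z = 0.
Proof.
pose X i : {mpoly k[3]} := 'X_(inord i).
have X_neq0 i : X i != 0 by rewrite -msupp_eq0 msuppX.
pose R0 := rest0 (@mpolyC 3 k) (X 0) (X 1); pose R1 := rest1 (@mpolyC 3 k) (X 0) (X 1).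
pose W := (msize R0 + msize R1).+1.
pose M0 := X 0 ^+ 2 * X 1 ^+ 2 * X 2 ^+ W; pose M1 := X 0 * X 1 ^+ 2 * X 2 ^+ W.
pose psi0 := R0 + M0; pose psi1 := R1 + (- 2) *: M1; pose psi2 := X 2 ^+ W + (base 15)%:MP.
pose psi := [tuple psi0; psi1; psi2].
have lead_M0 : mlead M0 = (U_(inord 0) *+ 2 + U_(inord 1) *+ 2 + U_(inord 2) *+ W)%MM.
  by rewrite !mleadM ?mulf_neq0 ?expf_neq0 // !mleadX // !mleadXm.
have lead_M1 : mlead M1 = (U_(inord 0) + U_(inord 1) *+ 2 + U_(inord 2) *+ W)%MM.
  by rewrite !mleadM ?mulf_neq0 ?expf_neq0 // !mleadX // !mleadXm.
have lead_psi0 : mlead psi0 = mlead M0.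
  rewrite mleadDr //; apply: lt_mdeg_ltmc; apply: leq_ltn_trans (mdeg_mlead_le _) _.
  rewrite lead_M0 !mdegD !mdegMn !mdeg1 !mul1n addnC ltn_addr // ltnS.
  exact: leq_addr.
have lead_psi1 : mlead psi1 = mlead M1.
  rewrite -(mleadZ M1 (c := - 2)) ?oppr_eq0 // mleadDr // mleadZ ?oppr_eq0 //.
  apply: lt_mdeg_ltmc; apply: leq_ltn_trans (mdeg_mlead_le _) _.
  rewrite lead_M1 !mdegD !mdegMn !mdeg1 !mul1n addnC ltn_addr // ltnS.
  exact: leq_addl.
have lead_psi2 : mlead psi2 = (U_(inord 2) *+ W)%MM.
  have lead_XW : mlead (X 2 ^+ W) = (U_(inord 2) *+ W)%MM by rewrite mleadX // mleadXm.
  rewrite mleadDl lead_XW // mleadC; apply: lt_mdeg_ltmc.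
  by rewrite mdeg0 mdegMn mdeg1 mul1n.
have psi_eval x : [/\ psi0.@[x] = rest0 id (x (inord 0)) (x (inord 1))
    + x (inord 0) ^+ 2 * x (inord 1) ^+ 2 * x (inord 2) ^+ W,
  psi1.@[x] = rest1 id (x (inord 0)) (x (inord 1))
    - 2 * (x (inord 0) * x (inord 1) ^+ 2 * x (inord 2) ^+ W)
  & psi2.@[x] = x (inord 2) ^+ W + base 15].
  have [] := @rmorph_rest _ _ (meval x) (@mpolyC 3 k) id (X 0) (X 1) (mevalC x).
  rewrite -/R0 -/R1 /= !mevalXU => e0 e1.
  have eX i n : (X i ^+ n).@[x] = x (inord i) ^+ n.
    by rewrite -[LHS]/(meval x _) rmorphXn /= mevalXU.
  have eM0 : M0.@[x] = x (inord 0) ^+ 2 * x (inord 1) ^+ 2 * x (inord 2) ^+ W.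
    by rewrite -!eX -!mevalM.
  have eM1 : M1.@[x] = x (inord 0) * x (inord 1) ^+ 2 * x (inord 2) ^+ W.
    by rewrite -!eX -[x (inord 0)](mevalXU x) -!mevalM.
  split; first by rewrite -eM0 -e0 -mevalD.
    by rewrite -eM1 -e1 -mulNr -mevalZ -mevalD.
  by rewrite mevalD eX mevalC.
pose coord := [tuple match (n : nat) with
  | 0 => X 0 | 1 => X 1 | 15 => X 2 | n => (z n)%:MP end | n < 22].
have coord_eval x : (f \mPo coord).@[x] = value (fun n => match n with
  | 0 => x (inord 0) | 1 => x (inord 1) | 15 => x (inord 2) | n => z n end).
  rewrite comp_mpoly_meval; apply: meval_eq => n; rewrite tnth_mktuple.
  by case: n; do 22![case=> [? /=|]; first by rewrite ?mevalXU ?mevalC].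
(* With the other coordinates fixed at [z], [f] vanishes on the independent polynomials [psi], hence
   identically in coordinates 0, 1 and 15. *)
have f0 : f \mPo coord = 0.
  apply: (@comp_mpoly_inj _ _ _ psi) => [i|e e' /mnmP E|].
  - have lead_neq0 (p' : {mpoly k[3]}) : (mlead p' (inord 2) != 0)%N -> p' != 0.
      by apply: contraNneq => ->; rewrite mlead0 mnm0E.
    rewrite (tnth_nth 0); apply: lead_neq0.
    case: i => -[|[|[|//]]] lt_i; rewrite /= ?lead_psi0 ?lead_psi1 ?lead_psi2 ?lead_M0 ?lead_M1
      !(mulmnE, mnmDE) !mnm1E -!val_eqE /= !inordK //=.
  - have o1 : lift ord0 ord0 = 1 :> 'I_3 by apply/val_inj.
    have o2 : lift ord0 (lift ord0 ord0) = 2 :> 'I_3 by apply/val_inj.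
    have {}E j : (mlead psi0 j * e 0%R + (mlead psi1 j * e 1%R + mlead psi2 j * e 2%R)
        = mlead psi0 j * e' 0%R + (mlead psi1 j * e' 1%R + mlead psi2 j * e' 2%R))%N.
      have := E j; rewrite !mnm_sumE !big_ord_recl !big_ord0 !mulmnE.
      by rewrite !(tnth_nth 0) /= !addn0 o1 o2.
    (* The exponent vectors (2, 2, W), (1, 2, W), (0, 0, W) are linearly independent. *)
    have E0 := E (inord 0); have E1 := E (inord 1); have E2 := E (inord 2).
    move: E0 E1 E2; rewrite lead_psi0 lead_psi1 lead_psi2 lead_M0 lead_M1.
    rewrite !(mulmnE, mnmDE) !mnm1E -!val_eqE /= !inordK //= => E0 E1 E2.
    rewrite !(mul0n, mul1n, add0n, addn0) in E0 E1 E2.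
    have [e0 e1] : e 0%R = e' 0%R /\ e 1%R = e' 1%R.
      by apply: (@linear_system2_inj 2 2 1 2); rewrite ?mul1n.
    have e2 : e 2%R = e' 2%R.
      by move/eqP: E2; rewrite e0 e1 !eqn_add2l eqn_pmul2l // => /eqP.
    apply/mnmP; case=> -[|[|[|//]]] lt_i.
    - by have -> : Ordinal lt_i = 0 by apply/val_inj.
    - by have -> : Ordinal lt_i = 1 by apply/val_inj.
    - by have -> : Ordinal lt_i = 2 by apply/val_inj.
apply: (mpoly_eq0_inf k_inf) => x; rewrite comp_mpoly_meval.
rewrite coord_eval; have [e0 e1 e2] := psi_eval x.
rewrite -[RHS](value_double_point (x (inord 0)) (x (inord 1)) (x (inord 2) ^+ W)).
rewrite -e0 -e1 -e2; apply: meval_eq => n.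
by rewrite !(tnth_nth 0) !inordK.
have := coord_eval (fun i => nth 0 [:: z 0; z 1; z 15] i); rewrite f0 meval0 => /esym vz.
rewrite -[RHS]vz; apply: meval_eq; case; rewrite !inordK //.
by do 22![case=> [? //|]].
Qed.

End Coordinates.

(** The factor 'X_(inord 21) takes care of points where this coordinate is 0 and the square cannot
    be completed. *)
Lemma vanishing_on_orbit : f = 0.
Proof.
have X_neq0 : 'X_(inord 21) != 0 :> {mpoly k[22]} by rewrite -msupp_eq0 msuppX.
have : f * 'X_(inord 21) = 0.
  apply: (mpoly_eq0_inf k_inf) => x; rewrite mevalM mevalXU.
  have [->|x_neq0] := eqVneq (x (inord 21)) 0; first by rewrite mulr0.
  have := value_eq0 (z := fun n => x (inord n)) x_neq0.
  have -> : value (fun n => x (inord n)) = f.@[x].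
    by apply: meval_eq => n; rewrite inord_val.
  by move=> ->; rewrite mul0r.
by move/eqP; rewrite mulf_eq0 (negPf X_neq0) orbF => /eqP.
Qed.

End Density.

Unset Implicit Arguments.

Theorem theorem7p15 (k : fieldType) (k_inf : infinite_type k)
    (k_char : 2%N \notin [pchar k]) :
  (forall v : 'rV[k]_22,
     ph v 2 != 0 ->
     in_U v ->
     smooth_generic_fibre (C10 v) ->
     (pc v 3 != 0 \/ exists r : k, r ^+ 2 = - (pa v 2 * ph v 2)) ->
     unirational [:: 2; 2; 0]%N (C10 v))
  /\ is_subvariety (@U' k)
  /\ zariski_dense (orbit_of [:: 2; 2; 0]%N (@U' k)).
Proof.
split=> [v h_neq0 vU smooth bisection|].
  (* For nonzero c_3 the double cover gives a bisection; otherwise the square root [r] gives a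
     section. *)
  have [c3_0|c3_neq0] := eqVneq (pc v 3) 0; last exact: unirational_bisection.
  case: bisection => [|[r r2]]; first by rewrite c3_0 eqxx.
  exact: unirational_section r2.
split; first exact: U'_subvariety.
move=> f _ f_orbit; apply: (vanishing_on_orbit k_inf _ f_orbit).
exact: (two_neq0 k_char idfun).
Qed.
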